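(* For every graph $G$ there exists a quantum algorithm $\mathcal{A}$ (of the type described in the context) that generates the graph state $|G\rangle$ from $|0\rangle^{\otimes(n+s)}$ with probability $1$ for some $s\ge 0$, where $n=|V(G)|$, whose CZ-complexity equals $\Gamma_{\mathrm{CZ}}(|G\rangle)$, and in which all two-qubit Clifford operations are controlled-Z operations.
   Context: Graphs are finite, simple and undirected. The Pauli group $\mathcal{G}_n$ consists of all $\alpha h_1\otimes\dots\otimes h_n$ with $\alpha\in\{\pm1,\pm i\}$, $h_j\in\{I_2,X,Y,Z\}$. The $n$-qubit Clifford group is $\mathcal{C}_n=\{U\in U(2^n): U\mathcal{G}_nU^\dagger=\mathcal{G}_n\}$; it is generated by the Hadamard gate $H$, the phase gate $S=\mathrm{diag}(1,i)$ and the controlled-Z gate $\mathrm{CZ}=\mathrm{diag}(1,1,1,-1)$. For a graph $G=(V,E)$ with $V=\{1,\dots,n\}$, the graph state $|G\rangle$ is the $n$-qubit state (unique up to global phase) that is fixed by $X_v\otimes\bigotimes_{w\in N_G(v)}Z_w$ for all $v\in V$. States are considered up to global phase. Algorithms: a quantum algorithm $\mathcal{A}$ consists of the following operations: (1) measurements of qubits in the computational basis (measured qubits are discarded); (2) single-qubit Clifford operations; (3) two-qubit Clifford operations (elements of $\mathcal{C}_2$ applied to any pair of qubits). Later operations may depend on earlier measurement outcomes. The CZ-complexity of $\mathcal{A}$ is the maximum, over measurement outcomes, of the number of two-qubit Clifford operations in $\mathcal{A}$. The CZ-complexity $\Gamma_{\mathrm{CZ}}(|G\rangle)$ of an $n$-qubit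 graph state is the minimum CZ-complexity of an algorithm that generates $|G\rangle$ from $|0\rangle^{\otimes(n+s)}$ with probability $1$ for some $s\ge0$. *)

(* Defs.v *)
From mathcomp Require Export all_boot all_order all_algebra.
From mathcomp Require Export boolp classical_sets reals.
From mathcomp Require Export complex.

Set Implicit Arguments.
Unset Strict Implicit.
Unset Printing Implicit Defensive.

Import Order.TTheory GRing.Theory Num.Theory.
Local Open Scope classical_set_scope.
Local Open Scope ring_scope.
Local Open Scope sesquilinear_scope.

(* The complex numbers are R[i] for a realType R.  The computational basis of n
   qubits is indexed by bit strings: #|bits n| = 2 ^ n, and the rows and columns
   of matrices are matched with bit strings through enum_rank / enum_val, which
   makes tensor products, gates on chosen qubits and measurements direct
   formulas. *)
Notation bits n := {ffun 'I_n -> bool}.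

Notation state R n := 'cV[R[i]]_#|{ffun 'I_n -> bool}|.
Notation oper R n := 'M[R[i]]_#|{ffun 'I_n -> bool}|.

Definition mkstate (R : realType) (n : nat) (f : bits n -> R[i]) : state R n :=
  \col_i f (enum_val i).

Definition amp (R : realType) (n : nat) (psi : state R n) (x : bits n) : R[i] :=
  psi (enum_rank x) 0.

Definition mkoper (R : realType) (n : nat) (f : bits n -> bits n -> R[i]) :
    oper R n :=
  \matrix_(i, j) f (enum_val i) (enum_val j).

Definition entry (R : realType) (n : nat) (U : oper R n) (x y : bits n) : R[i] :=
  U (enum_rank x) (enum_rank y).

Definition sqnorm (R : realType) (n : nat) (psi : state R n) : R[i] :=
  \sum_(x : bits n) `|amp psi x| ^+ 2.

Definition zero_state (R : realType) (n : nat) : state R n :=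
  mkstate (fun x => (x == [ffun=> false])%:R).

(* A 2 x 2 matrix is given as a function of its row bit and column bit;
   tensor h is h 0 (x) h 1 (x) ... (x) h (n - 1). *)
Definition tensor (R : realType) (n : nat) (h : 'I_n -> bool -> bool -> R[i]) :
    oper R n :=
  mkoper (fun x y => \prod_(j < n) h j (x j) (y j)).

Inductive pauli := PauliI | PauliX | PauliY | PauliZ.

Definition pauli_mx (R : realType) (P : pauli) (a b : bool) : R[i] :=
  match P with
  | PauliI => (a == b)%:R
  | PauliX => (a != b)%:R
  | PauliY => if a == b then 0 else if a then 'i else - 'i
  | PauliZ => if a == b then (-1) ^+ a else 0
  end.

Definition pauli_group (R : realType) (n : nat) : set (oper R n) :=
  [set A | exists (alpha : R[i]) (h : 'I_n -> pauli),
     alpha \in [:: 1; -1; 'i; - 'i] /\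
     A = alpha *: tensor (fun j => pauli_mx R (h j))].

Definition clifford (R : realType) (n : nat) : set (oper R n) :=
  [set U | U \is unitarymx /\
     [set U *m P *m U^t* | P in @pauli_group R n] = @pauli_group R n].

Definition cz_gate (R : realType) : oper R 2 :=
  mkoper (fun x y => if x == y then (-1) ^+ (x ord0 && x ord_max) else 0).

(* The k-qubit operator U acting on the wires w 0, ..., w (k - 1) of n qubits
   (w is meant to be injective), and as the identity on the other wires. *)
Definition on_wires (R : realType) (n k : nat) (w : 'I_k -> 'I_n)
    (U : oper R k) : oper R n :=
  mkoper (fun x y =>
    if [forall j, (j \notin codom w) ==> (x j == y j)]
    then entry U [ffun i => x (w i)] [ffun i => y (w i)] else 0).

Definition wires1 (n : nat) (q : 'I_n) : 'I_1 -> 'I_n := fun=> q.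

Definition wires2 (n : nat) (p q : 'I_n) : 'I_2 -> 'I_n :=
  fun i => if i == ord0 then p else q.

Definition insert_bit (n : nat) (q : 'I_n.+1) (b : bool) (x : bits n) :
    bits n.+1 :=
  [ffun j => if unlift q j is Some i then x i else b].

(* Outcome b of a computational-basis measurement of qubit q, which is then
   discarded; the others keep their order.  The result is not renormalized: its
   squared norm is the probability of the outcome times that of psi. *)
Definition measure_out (R : realType) (n : nat) (q : 'I_n.+1) (b : bool)
    (psi : state R n.+1) : state R n :=
  mkstate (fun x => amp psi (insert_bit q b x)).

(* algo R n k: algorithms that start with k qubits and end with n qubits.  The
   continuation of a measurement is a function of its outcome. *)
Inductive algo (R : realType) (n : nat) : nat -> Type :=
| Stop : algo R n n
| Measure (k : nat) (q : 'I_k.+1) (next : bool -> algo R n k) : algo R n k.+1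
| Gate1 (k : nat) (q : 'I_k) (U : oper R 1) (HU : @clifford R 1 U)
    (next : algo R n k) : algo R n k
| Gate2 (k : nat) (p q : 'I_k) (Hpq : p != q) (U : oper R 2)
    (HU : @clifford R 2 U) (next : algo R n k) : algo R n k.

Fixpoint cz_complexity (R : realType) (n k : nat) (A : algo R n k) : nat :=
  match A with
  | Stop => 0
  | Measure _ _ next =>
      maxn (cz_complexity (next false)) (cz_complexity (next true))
  | Gate1 _ _ _ _ next => cz_complexity next
  | Gate2 _ _ _ _ _ _ next => (cz_complexity next).+1
  end.

Fixpoint only_cz (R : realType) (n k : nat) (A : algo R n k) : Prop :=
  match A with
  | Stop => True
  | Measure _ _ next => forall b, only_cz (next b)
  | Gate1 _ _ _ _ next => only_cz next
  | Gate2 _ _ _ _ U _ next => U = cz_gate R /\ only_cz next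
  end.

(* The probability that A, run on the unit vector psi, ends in a state
   satisfying good: the total squared norm of the unnormalized final states
   that satisfy good. *)
Fixpoint success_prob (R : realType) (n : nat) (good : set (state R n))
    (k : nat) (A : algo R n k) : state R k -> R[i] :=
  match A in algo _ _ k return state R k -> R[i] with
  | Stop => fun psi => if `[< good psi >] then sqnorm psi else 0
  | Measure _ q next => fun psi =>
      \sum_(b : bool) success_prob good (next b) (measure_out q b psi)
  | Gate1 _ q U _ next => fun psi =>
      success_prob good next (on_wires (wires1 q) U *m psi)
  | Gate2 _ p q _ U _ next => fun psi =>
      success_prob good next (on_wires (wires2 p q) U *m psi)
  end.

Definition graph_stabilizer (R : realType) (n : nat) (e : rel 'I_n) (v : 'I_n) :
    oper R n :=
  tensor (fun w => pauli_mx R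
    (if w == v then PauliX else if e v w then PauliZ else PauliI)).

Definition is_graph_state (R : realType) (n : nat) (e : rel 'I_n)
    (psi : state R n) : Prop :=
  sqnorm psi = 1 /\ forall v, graph_stabilizer R e v *m psi = psi.

(* Final states are unnormalized and considered up to a global phase. *)
Definition generates (R : realType) (n : nat) (e : rel 'I_n) (k : nat)
    (A : algo R n k) : Prop :=
  success_prob
    [set phi | exists (c : R[i]) (psi : state R n),
       is_graph_state e psi /\ phi = c *: psi]
    A (zero_state R k) = 1.

(* The default value 0 would only be taken if no algorithm generated |G>. *)
Definition Gamma_cz (R : realType) (n : nat) (e : rel 'I_n) : nat :=
  let costs := [set m : nat | exists (s : nat) (A : algo R n (n + s)),
                  generates e A /\ cz_complexity A = m] in
  xget 0%N [set m | costs m /\ forall m', costs m' -> (m <= m')%N].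

(* Main.v *)
Require Import Defs.
From mathcomp Require Import perm ring.

(** Up to single-qubit Cliffords and a swap of its two qubits, a two-qubit
    Clifford operation is the identity or one controlled-Z; a swap costs nothing
    when it is absorbed in a relabelling of the wires. The relabelling may depend
    on the measurement outcomes, so one sequence of outcomes is fixed: on a
    stabilizer state the two outcomes of a measurement leave states that agree
    up to a Pauli (or one of them has probability zero), so the unwanted outcome
    can be turned into the chosen one by single-qubit operations. Along the chosen
    sequence the relabelling is one permutation, which is moved to the beginning,
    where it fixes |0...0>. *)

Set Implicit Arguments.
Unset Strict Implicit.
Unset Printing Implicit Defensive.

Import Order.TTheory GRing.Theory Num.Theory.
Local Open Scope classical_set_scope.
Local Open Scope ring_scope.
Local Open Scope sesquilinear_scope.

(** * Operators on chosen qubits *)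

(** A two-qubit Clifford is classified by the images of X⊗I and Z⊗I alone. Once local gates, a swap
    and at most one CZ have brought these images back to X⊗I and Z⊗I up to sign, a Pauli on the
    first qubit repairs the signs; what remains commutes with X and Z of the first qubit and hence,
    by Schur, acts on the second qubit only. Only commutation signs enter this argument, so Paulis
    are handled through their labels and scalars are left arbitrary, which is harmless because
    multiples of a graph state remain good. Algorithms are converted from their end towards their
    beginning. What precedes a measurement is common to both outcomes and can carry one permutation
    only; this is why being a stabilizer state has to be an invariant of the induction. It is
    expressed by a dichotomy for each single Pauli, which gates and measurements preserve without
    any choice of generators. *)

Section Operators.
Variable R : realType.
Local Notation C := R[i].

Lemma entryK n (f : bits n -> bits n -> C) x y : entry (mkoper f) x y = f x y.
Proof. by rewrite /entry mxE !enum_rankK. Qed.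

Lemma ampK n (f : bits n -> C) x : amp (mkstate f) x = f x.
Proof. by rewrite /amp mxE enum_rankK. Qed.

Lemma operP n (A B : oper R n) : (forall x y, entry A x y = entry B x y) -> A = B.
Proof.
move=> AB; apply/matrixP => i j; rewrite -(enum_valK i) -(enum_valK j); exact: AB.
Qed.

Lemma stateP n (u v : state R n) : (forall x, amp u x = amp v x) -> u = v.
Proof.
move=> uv; apply/matrixP => i j; rewrite -(enum_valK i) !ord1; exact: uv.
Qed.

Lemma entry_mul n (A B : oper R n) x y :
  entry (A *m B) x y = \sum_z entry A x z * entry B z y.
Proof.
rewrite /entry mxE (reindex enum_rank) //=.
by exists enum_val => z _; rewrite ?enum_rankK ?enum_valK.
Qed.

Lemma amp_mul n (A : oper R n) (u : state R n) x :
  amp (A *m u) x = \sum_z entry A x z * amp u z.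
Proof.
rewrite /amp mxE (reindex enum_rank) //=.
by exists enum_val => z _; rewrite ?enum_rankK ?enum_valK.
Qed.

Lemma entry1 n x y : entry (1%:M : oper R n) x y = (x == y)%:R.
Proof. by rewrite /entry mxE (inj_eq enum_rank_inj). Qed.

Lemma entryZ n (c : C) (A : oper R n) x y : entry (c *: A) x y = c * entry A x y.
Proof. by rewrite /entry mxE. Qed.

Lemma entry_adj n (A : oper R n) x y : entry (A ^t*) x y = (entry A y x)^*.
Proof. by rewrite /entry !mxE. Qed.

Lemma ampZ n (c : C) (u : state R n) x : amp (c *: u) x = c * amp u x.
Proof. by rewrite /amp mxE. Qed.

Lemma amp0 n x : amp (0 : state R n) x = 0.
Proof. by rewrite /amp mxE. Qed.

Definition overwrite n k (w : 'I_k -> 'I_n) (x : bits n) (y : bits k) : bits n :=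
  [ffun j => if [pick i | w i == j] is Some i then y i else x j].

Lemma overwrite_in n k (w : 'I_k -> 'I_n) x y i :
  injective w -> overwrite w x y (w i) = y i.
Proof.
move=> w_inj; rewrite ffunE; case: pickP => [j /eqP/w_inj-> //|/(_ i)].
by rewrite eqxx.
Qed.

Lemma overwrite_out n k (w : 'I_k -> 'I_n) x y j :
  j \notin codom w -> overwrite w x y j = x j.
Proof.
move=> jw; rewrite ffunE; case: pickP => // i /eqP wi.
by rewrite -wi codom_f in jw.
Qed.

Definition agree_off n k (w : 'I_k -> 'I_n) (x y : bits n) :=
  [forall j, (j \notin codom w) ==> (x j == y j)].

(** A string that agrees with [x] off the wires is determined by its bits on the wires. This reduces
    every product with an [on_wires] operator to a product of [k]-qubit operators. *)
Lemma sum_wires n k (w : 'I_k -> 'I_n) (x : bits n) (F : bits n -> C) :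
  injective w ->
  \sum_(z : bits n | agree_off w x z) F z =
  \sum_(y : bits k) F (overwrite w x y).
Proof.
move=> w_inj.
rewrite (reindex_onto (overwrite w x) (fun z => [ffun i => z (w i)])) /=.
  apply: eq_bigl => y; apply/andP; split.
    by apply/forallP => j; apply/implyP => jw; rewrite overwrite_out.
  by apply/eqP/ffunP => i; rewrite ffunE overwrite_in.
move=> z /forallP xz; apply/ffunP => j.
have [/codomP[i ->]|jw] := boolP (j \in codom w).
  by rewrite overwrite_in // ffunE.
by rewrite overwrite_out //; apply/eqP; have /implyP := xz j; apply.
Qed.

Lemma prod_wires n k (w : 'I_k -> 'I_n) (F : 'I_n -> C) : injective w ->
  \prod_j F j = (\prod_(j | j \notin codom w) F j) * \prod_i F (w i).
Proof.
move=> w_inj; rewrite (bigID (mem (codom w))) /= mulrC; congr (_ * _).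
rewrite -big_uniq ?[codom w]/(image w _) ?big_image //.
by rewrite map_inj_uniq ?enum_uniq.
Qed.

Lemma agree_overwrite n k (w : 'I_k -> 'I_n) x y u :
  agree_off w (overwrite w x u) y = agree_off w x y.
Proof.
apply: eq_forallb => j; have [//|jw] /= := boolP (j \in codom w).
by rewrite overwrite_out.
Qed.

Lemma restrict_overwrite n k (w : 'I_k -> 'I_n) x u : injective w ->
  [ffun i => overwrite w x u (w i)] = u.
Proof. by move=> wi; apply/ffunP => i; rewrite ffunE overwrite_in. Qed.

Lemma agree_off_sym n k (w : 'I_k -> 'I_n) x y : agree_off w x y = agree_off w y x.
Proof. by apply: eq_forallb => j; rewrite eq_sym. Qed.

Lemma entry_on_wires n k (w : 'I_k -> 'I_n) (U : oper R k) x y :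
  entry (on_wires w U) x y =
  if agree_off w x y then entry U [ffun i => x (w i)] [ffun i => y (w i)] else 0.
Proof. by rewrite entryK. Qed.

Lemma on_wires_mul n k (w : 'I_k -> 'I_n) (U V : oper R k) : injective w ->
  on_wires w (U *m V) = on_wires w U *m on_wires w V.
Proof.
move=> w_inj; apply: operP => x y; rewrite entry_mul entry_on_wires.
rewrite (eq_bigr (fun z => if agree_off w x z then
  entry U [ffun i => x (w i)] [ffun i => z (w i)] * entry (on_wires w V) z y else 0)).
  rewrite -big_mkcond sum_wires // entry_mul.
  case: ifP => xy.
    apply: eq_bigr => z _.
    by rewrite entry_on_wires agree_overwrite xy restrict_overwrite.
  by rewrite big1 // => z _; rewrite entry_on_wires agree_overwrite xy mulr0.
by move=> z _; rewrite entry_on_wires; case: ifP; rewrite ?mul0r.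
Qed.

Lemma on_wires1 n k (w : 'I_k -> 'I_n) : injective w ->
  on_wires w (1%:M : oper R k) = 1%:M.
Proof.
move=> w_inj; apply: operP => x y; rewrite entry_on_wires !entry1.
case: ifPn => [/forallP xy|nxy]; last first.
  case: eqP => // exy; case/negP: nxy; rewrite exy; apply/forallP => j.
  by rewrite eqxx implybT.
congr (nat_of_bool _)%:R; apply/eqP/eqP => [/ffunP exy|->//].
apply/ffunP => j; have [/codomP[i ->]|jw] := boolP (j \in codom w).
  by have := exy i; rewrite !ffunE.
by apply/eqP; have /implyP := xy j; apply.
Qed.

Lemma on_wires_adj n k (w : 'I_k -> 'I_n) (U : oper R k) :
  (on_wires w U) ^t* = on_wires w (U ^t*).
Proof.
apply: operP => x y; rewrite entry_adj !entry_on_wires entry_adj agree_off_sym.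
by case: ifP => // _; rewrite conjC0.
Qed.

Lemma on_wires_unitary n k (w : 'I_k -> 'I_n) (U : oper R k) :
  injective w -> U \is unitarymx -> on_wires w U \is unitarymx.
Proof.
move=> w_inj /unitarymxP UU; apply/unitarymxP.
by rewrite on_wires_adj -on_wires_mul // UU on_wires1.
Qed.

Lemma on_wires_comp n k l (w : 'I_k -> 'I_n) (v : 'I_l -> 'I_k) (U : oper R l) :
  injective w -> on_wires w (on_wires v U) = on_wires (w \o v) U.
Proof.
move=> w_inj; apply: operP => x y; rewrite !entry_on_wires.
have -> : agree_off (w \o v) x y = agree_off w x y &&
    agree_off v [ffun i => x (w i)] [ffun i => y (w i)].
  apply/forallP/andP => [xy|[/forallP xy /forallP xyw] j].
    split; apply/forallP => j; apply/implyP => jw.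
      have /implyP := xy j; apply; apply: contra jw => /codomP[i ->].
      exact: codom_f.
    rewrite !ffunE; have /implyP := xy (w j); apply; apply: contra jw.
    by case/codomP => i /w_inj ->; apply: codom_f.
  apply/implyP => jwv; have [/codomP[i ji]|jw] := boolP (j \in codom w).
    have := xyw i; rewrite !ffunE -ji => /implyP; apply; apply: contra jwv.
    by case/codomP => h ih; rewrite ji ih; apply: (codom_f (w \o v)).
  by have /implyP := xy j; apply.
case: (agree_off w x y) => //=; case: ifP => // _.
by congr entry; apply/ffunP => i; rewrite !ffunE.
Qed.

Definition bool_mul (f g : bool -> bool -> C) a b := \sum_c f a c * g c b.

Lemma entry_tensor n (h : 'I_n -> bool -> bool -> C) x y :
  entry (tensor h) x y = \prod_j h j (x j) (y j).
Proof. by rewrite entryK. Qed.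

Lemma tensor_mul n (f g : 'I_n -> bool -> bool -> C) :
  tensor f *m tensor g = tensor (fun j => bool_mul (f j) (g j)).
Proof.
apply: operP => x y; rewrite entry_mul entry_tensor bigA_distr_bigA /=.
by apply: eq_bigr => z _; rewrite !entry_tensor big_split.
Qed.

Lemma eq_tensor n (f g : 'I_n -> bool -> bool -> C) :
  (forall j a b, f j a b = g j a b) -> tensor f = tensor g.
Proof.
move=> fg; apply: operP => x y; rewrite !entry_tensor.
by apply: eq_bigr => j _; rewrite fg.
Qed.

Lemma on_wires_tensor_entry n k (w : 'I_k -> 'I_n) (U : oper R k)
    (h : 'I_n -> bool -> bool -> C) x y : injective w ->
  entry (on_wires w U *m tensor h) x y =
  (\prod_(j | j \notin codom w) h j (x j) (y j)) *
  entry (U *m tensor (fun i => h (w i))) [ffun i => x (w i)] [ffun i => y (w i)].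
Proof.
move=> w_inj; rewrite entry_mul (eq_bigr (fun z => if agree_off w x z then
  entry U [ffun i => x (w i)] [ffun i => z (w i)] * entry (tensor h) z y else 0)).
  rewrite -big_mkcond sum_wires // entry_mul mulr_sumr; apply: eq_bigr => z _.
  rewrite restrict_overwrite // !entry_tensor (prod_wires _ w_inj) mulrCA.
  congr (_ * (_ * _)).
    by apply: eq_bigr => j jw; rewrite overwrite_out.
  by apply: eq_bigr => i _; rewrite overwrite_in // ffunE.
by move=> z _; rewrite entry_on_wires; case: ifP; rewrite ?mul0r.
Qed.

Lemma tensor_on_wires_entry n k (w : 'I_k -> 'I_n) (U : oper R k)
    (h : 'I_n -> bool -> bool -> C) x y : injective w ->
  entry (tensor h *m on_wires w U) x y =
  (\prod_(j | j \notin codom w) h j (x j) (y j)) *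
  entry (tensor (fun i => h (w i)) *m U) [ffun i => x (w i)] [ffun i => y (w i)].
Proof.
move=> w_inj; rewrite entry_mul (eq_bigr (fun z => if agree_off w y z then
  entry (tensor h) x z * entry U [ffun i => z (w i)] [ffun i => y (w i)] else 0)).
  rewrite -big_mkcond sum_wires // entry_mul mulr_sumr; apply: eq_bigr => z _.
  rewrite restrict_overwrite // !entry_tensor (prod_wires _ w_inj) -mulrA.
  congr (_ * (_ * _)).
    by apply: eq_bigr => j jw; rewrite overwrite_out.
  by apply: eq_bigr => i _; rewrite overwrite_in // ffunE.
move=> z _; rewrite entry_on_wires agree_off_sym.
by case: ifP; rewrite ?mulr0.
Qed.

(** Both products factor into the entries off the wires, where [f] and [g] coincide, and a [k]-qubit
    product. Gate identities on Paulis are thus checked on one or two qubits and transported to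
    [n]. *)
Lemma on_wires_conj_tensor n k (w : 'I_k -> 'I_n) (U : oper R k) (c : C)
    (f g : 'I_n -> bool -> bool -> C) : injective w ->
  (forall j, j \notin codom w -> f j = g j) ->
  U *m tensor (fun i => f (w i)) = c *: (tensor (fun i => g (w i)) *m U) ->
  on_wires w U *m tensor f = c *: (tensor g *m on_wires w U).
Proof.
move=> w_inj fg UU; apply: operP => x y; rewrite entryZ.
rewrite on_wires_tensor_entry // tensor_on_wires_entry // UU entryZ mulrCA.
by congr (_ * (_ * _)); apply: eq_bigr => j jw; rewrite fg.
Qed.

End Operators.

(** * Pauli and Clifford operators *)

(** The symplectic form on Paulis modulo phase, seen as a plane over the field with two elements;
    [anticomm] is its sum over the qubits. *)
Definition anticomm1 (p q : pauli) : bool :=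
  match p, q with
  | PauliI, _ | _, PauliI => false
  | PauliX, PauliX | PauliY, PauliY | PauliZ, PauliZ => false
  | _, _ => true
  end.

(** The product modulo phase, hence commutative; the scalar is kept apart in [pauli_phase]. *)
Definition pauli_mul (p q : pauli) : pauli :=
  match p, q with
  | PauliI, r | r, PauliI => r
  | PauliX, PauliX | PauliY, PauliY | PauliZ, PauliZ => PauliI
  | PauliX, PauliY | PauliY, PauliX => PauliZ
  | PauliY, PauliZ | PauliZ, PauliY => PauliX
  | PauliZ, PauliX | PauliX, PauliZ => PauliY
  end.

Lemma anticomm1_mul p q r :
  anticomm1 (pauli_mul p q) r = anticomm1 p r (+) anticomm1 q r.
Proof. by case: p; case: q; case: r. Qed.

Definition anticomm n (g h : 'I_n -> pauli) : bool :=
  \big[addb/false]_j anticomm1 (g j) (h j).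

Section Paulis.
Variable R : realType.
Local Notation C := R[i].

Definition phases : seq C := [:: 1; -1; 'i; - 'i].

Definition pauli_phase (p q : pauli) : C :=
  match p, q with
  | PauliX, PauliY | PauliY, PauliZ | PauliZ, PauliX => 'i
  | PauliY, PauliX | PauliZ, PauliY | PauliX, PauliZ => - 'i
  | _, _ => 1
  end.

Lemma bool_mulE (f g : bool -> bool -> C) a b :
  bool_mul f g a b = f a true * g true b + f a false * g false b.
Proof. by rewrite /bool_mul big_bool. Qed.

Lemma pauli_mulE p q a b : bool_mul (pauli_mx R p) (pauli_mx R q) a b =
  pauli_phase p q * pauli_mx R (pauli_mul p q) a b.
Proof.
have i2 := sqrCi C.
rewrite bool_mulE; case: p; case: q; case: a; case: b;
  rewrite /= ?expr0 ?expr1; by ring: i2.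
Qed.

Lemma pauli_phase_neq0 p q : pauli_phase p q != 0.
Proof. by case: p; case: q; rewrite /= ?oppr_eq0 ?neq0Ci ?oner_eq0. Qed.

Lemma pauli_phaseC p q :
  pauli_phase p q = (-1) ^+ anticomm1 p q * pauli_phase q p.
Proof. by case: p; case: q; rewrite /= ?expr1 ?expr0 ?mul1r ?mulN1r ?opprK. Qed.

Definition ptensor n (h : 'I_n -> pauli) : oper R n :=
  tensor (fun j => pauli_mx R (h j)).

Lemma tensor_scale n (c : 'I_n -> C) (f : 'I_n -> bool -> bool -> C) :
  tensor (fun j a b => c j * f j a b) = (\prod_j c j) *: tensor f.
Proof. by apply: operP => x y; rewrite entryZ !entry_tensor big_split. Qed.

Lemma ptensor_mul n (g h : 'I_n -> pauli) :
  ptensor g *m ptensor h =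
  (\prod_j pauli_phase (g j) (h j)) *: ptensor (fun j => pauli_mul (g j) (h j)).
Proof.
rewrite tensor_mul -tensor_scale; apply: eq_tensor => j a b.
exact: pauli_mulE.
Qed.

Lemma pauli_phase_prod_neq0 n (g h : 'I_n -> pauli) :
  \prod_j pauli_phase (g j) (h j) != 0.
Proof. by apply/prodf_neq0 => j _; apply: pauli_phase_neq0. Qed.

Lemma sign_anticomm n (g h : 'I_n -> pauli) :
  (-1) ^+ anticomm g h = \prod_j (-1) ^+ anticomm1 (g j) (h j) :> C.
Proof.
rewrite (big_morph (fun b : bool => (-1) ^+ b : C) (id1 := 1) (op1 := *%R)) //.
exact: signr_addb.
Qed.

Lemma ptensor_comm n (g h : 'I_n -> pauli) :
  ptensor g *m ptensor h = (-1) ^+ anticomm g h *: (ptensor h *m ptensor g).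
Proof.
rewrite !ptensor_mul scalerA sign_anticomm -big_split /=.
congr (_ *: _); first by apply: eq_bigr => j _; apply: pauli_phaseC.
by apply: eq_tensor => j; case: (g j); case: (h j).
Qed.

Lemma ptensor1 n : ptensor (fun _ : 'I_n => PauliI) = 1%:M.
Proof.
apply: operP => x y; rewrite entry1 entry_tensor /=.
case: eqP => [->|xy]; first by rewrite big1 // => j _; rewrite eqxx.
have [j xyj] : exists j, x j != y j.
  apply/existsP; apply: contra_notT xy; rewrite negb_exists => /forallP xy.
  by apply/ffunP => j; apply/eqP; rewrite -[_ == _]negbK.
by rewrite (bigD1 j) //= (negPf xyj) mul0r.
Qed.

Lemma ptensorK n (h : 'I_n -> pauli) : ptensor h *m ptensor h = 1%:M.
Proof.
rewrite ptensor_mul big1 ?scale1r => [|j _]; last by case: (h j).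
by rewrite -ptensor1; apply: eq_tensor => j; case: (h j).
Qed.

Lemma pauli_mx_adj p a b : (pauli_mx R p a b)^* = pauli_mx R p b a.
Proof.
by case: p; case: a; case: b;
  rewrite /= ?expr0 ?expr1 ?rmorphN ?conjC0 ?conjC1 /= ?conjCi ?opprK //
    ?rmorphN ?conjC1.
Qed.

Lemma ptensor_adj n (h : 'I_n -> pauli) : (ptensor h) ^t* = ptensor h.
Proof.
apply: operP => x y; rewrite entry_adj !entry_tensor rmorph_prod.
by apply: eq_bigr => j _; rewrite /= pauli_mx_adj.
Qed.

Lemma oper_neq0 n : (1%:M : oper R n) != 0.
Proof.
apply/eqP => /(congr1 (fun A => entry A [ffun=> false] [ffun=> false])).
rewrite entry1 eqxx /entry mxE => /eqP; rewrite oner_eq0 //.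
Qed.

Lemma phasesM a b : a \in phases -> b \in phases -> a * b \in phases.
Proof.
rewrite !inE => /or4P[] /eqP-> /or4P[] /eqP->;
  by rewrite ?mulrN ?mulNr ?mul1r ?mulr1 ?mulCii ?opprK ?eqxx ?orbT.
Qed.

Lemma phasesV a : a \in phases -> exists2 b, b \in phases & a * b = 1.
Proof.
by rewrite !inE => /or4P[] /eqP->; [exists 1|exists (-1)|exists (- 'i)|exists 'i];
  rewrite ?inE ?eqxx ?orbT ?mulrN ?mulNr ?mul1r ?mulr1 ?mulCii ?opprK ?orbT.
Qed.

Lemma phases_neq0 a : a \in phases -> a != 0.
Proof.
by rewrite !inE => /or4P[] /eqP->; rewrite ?oppr_eq0 ?neq0Ci ?oner_eq0.
Qed.

(** The equality of sets splits into two inclusions: Paulis are mapped to Paulis, and every Pauli is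
    reached. Written as commutation relations, both can be composed and lifted to more qubits
    without adjoints; phases change sides because they form a group. *)
Lemma cliffordP n (U : oper R n) : clifford U <->
  [/\ U \is unitarymx,
      forall h, exists a g, a \in phases /\ U *m ptensor h = a *: (ptensor g *m U) &
      forall h, exists a g, a \in phases /\ U *m ptensor g = a *: (ptensor h *m U)].
Proof.
split=> [[uU imU]|[uU imU imV]].
  have UV : U ^t* *m U = 1%:M by apply: mulmx1C; apply/unitarymxP.
  split=> // h.
    have [a [g [ap E]]] : pauli_group (U *m ptensor h *m U ^t*).
      rewrite -imU; exists (ptensor h) => //.
      by exists 1, h; rewrite scale1r inE eqxx.
    exists a, g; split=> //.
    by rewrite -[LHS]mulmx1 -UV mulmxA E -scalemxAl.
  have : pauli_group (ptensor h).
    by exists 1, h; rewrite scale1r inE eqxx.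
  rewrite -imU => -[_ [a [g [ap ->]]] E].
  have [b bp ab] := phasesV ap.
  exists b, g; split=> //; rewrite -E -(mulmxA _ (U ^t*)) UV mulmx1 -scalemxAr scalerA.
  by rewrite mulrC ab scale1r.
have UU := unitarymxP uU.
split=> //; apply/seteqP; split=> [_ [_ [a [h [ap ->]]] <-]|_ [a [h [ap ->]]]].
  have [b [g [bp E]]] := imU h.
  exists (a * b), g; split; first exact: phasesM.
  by rewrite -scalemxAr E -!scalemxAl -mulmxA UU mulmx1 scalerA.
have [b [g [bp E]]] := imV h; have [c cp bc] := phasesV bp.
exists ((a * c) *: ptensor g).
  by exists (a * c), g; split=> //; apply: phasesM.
rewrite -scalemxAr E -!scalemxAl -mulmxA UU mulmx1 scalerA -mulrA [c * b]mulrC.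
by rewrite bc mulr1.
Qed.

Lemma clifford_mul n (U V : oper R n) : clifford U -> clifford V -> clifford (U *m V).
Proof.
move=> /cliffordP[uU U1 U2] /cliffordP[uV V1 V2]; apply/cliffordP; split.
- apply/unitarymxP; rewrite trmx_mul map_mxM /= mulmxA -(mulmxA U).
  by rewrite (unitarymxP uV) mulmx1 (unitarymxP uU).
- move=> h; have [a [g [ap E]]] := V1 h; have [b [f [bp F]]] := U1 g.
  exists (a * b), f; split; first exact: phasesM.
  by rewrite -mulmxA E -scalemxAr (mulmxA U) F -scalemxAl scalerA mulmxA.
move=> h; have [a [g [ap E]]] := U2 h; have [b [f [bp F]]] := V2 g.
exists (b * a), f; split; first exact: phasesM.
by rewrite -mulmxA F -scalemxAr (mulmxA U) E -scalemxAl scalerA mulmxA.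
Qed.

Lemma clifford_adj n (U : oper R n) : clifford U -> clifford (U ^t*).
Proof.
move=> /cliffordP[/unitarymxP uU U1 U2]; have uV := mulmx1C uU.
have K : (U ^t*) ^t* = U by apply: operP => x y; rewrite !entry_adj conjCK.
apply/cliffordP; split; first by apply/unitarymxP; rewrite K.
- move=> h; have [a [g [ap E]]] := U2 h; have [b bp ab] := phasesV ap.
  exists b, g; split=> //.
  have -> : ptensor h = b *: (U *m ptensor g *m U ^t*).
    by rewrite E -scalemxAl -mulmxA uU mulmx1 scalerA mulrC ab scale1r.
  by rewrite -scalemxAr !mulmxA uV mul1mx.
move=> h; have [a [g [ap E]]] := U1 h; have [b bp ab] := phasesV ap.
exists b, g; split=> //.
have -> : ptensor g = b *: (U *m ptensor h *m U ^t*).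
  by rewrite E -scalemxAl -mulmxA uU mulmx1 scalerA mulrC ab scale1r.
by rewrite -scalemxAr !mulmxA uV mul1mx.
Qed.

(** When [U] is its own inverse, the image of a Pauli is also its preimage, so one inclusion gives
    the other. Paulis, the Hadamard-like gates, CZ and the swap are all of this kind. *)
Lemma clifford_involution n (U : oper R n) : U ^t* = U -> U *m U = 1%:M ->
  (forall h, exists a g, a \in phases /\ U *m ptensor h = a *: (ptensor g *m U)) ->
  clifford U.
Proof.
move=> Uadj UU imU; apply/cliffordP; split=> //.
  by apply/unitarymxP; rewrite Uadj.
move=> h; have [a [g [ap E]]] := imU h; have [b bp ab] := phasesV ap.
exists b, g; split=> //.
have -> : ptensor g = b *: (U *m ptensor h *m U).
  by rewrite E -scalemxAl -mulmxA UU mulmx1 scalerA mulrC ab scale1r.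
by rewrite -scalemxAr !mulmxA UU mul1mx.
Qed.

End Paulis.

(** * Permutations, measurements and success *)

Section States.
Variable R : realType.
Local Notation C := R[i].

(** Qubit [i] of [psi] moves to position [s i], so that a gate on the wires [w] becomes the same
    gate on [s \o w]. *)
Definition perm_state n (s : {perm 'I_n}) (psi : state R n) : state R n :=
  mkstate (fun x => amp psi [ffun i => x (s i)]).

Lemma amp_perm n (s : {perm 'I_n}) (psi : state R n) x :
  amp (perm_state s psi) x = amp psi [ffun i => x (s i)].
Proof. exact: ampK. Qed.

Lemma perm_stateZ n (s : {perm 'I_n}) c (psi : state R n) :
  perm_state s (c *: psi) = c *: perm_state s psi.
Proof. by apply: stateP => x; rewrite ampZ !amp_perm ampZ. Qed.

Lemma perm_state1 n (psi : state R n) : perm_state 1 psi = psi.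
Proof.
apply: stateP => x; rewrite amp_perm; congr amp.
by apply/ffunP => i; rewrite ffunE perm1.
Qed.

Lemma perm_stateM n (s t : {perm 'I_n}) (psi : state R n) :
  perm_state s (perm_state t psi) = perm_state (t * s) psi.
Proof.
apply: stateP => x; rewrite !amp_perm; congr amp.
by apply/ffunP => i; rewrite !ffunE permM.
Qed.

Lemma perm_state_zero n (s : {perm 'I_n}) :
  perm_state s (zero_state R n) = zero_state R n.
Proof.
apply: stateP => x; rewrite amp_perm !ampK; congr (nat_of_bool _)%:R.
apply/eqP/eqP => [/ffunP x0|->]; apply/ffunP => i; rewrite !ffunE //.
by have := x0 ((s^-1)%g i); rewrite !ffunE permKV.
Qed.

Lemma sum_perm n (s : {perm 'I_n}) (F : bits n -> C) :
  \sum_x F x = \sum_(x : bits n) F [ffun i => x (s i)].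
Proof.
apply: reindex; exists (fun x : bits n => [ffun i => x ((s^-1)%g i)]) => x _;
  by apply/ffunP => i; rewrite !ffunE ?permK ?permKV.
Qed.

Lemma perm_on_wires n k (s : {perm 'I_n}) (w : 'I_k -> 'I_n) (U : oper R k)
    (psi : state R n) :
  perm_state s (on_wires w U *m psi) = on_wires (s \o w) U *m perm_state s psi.
Proof.
apply: stateP => x; rewrite amp_perm !amp_mul (sum_perm s).
apply: eq_bigr => y _; rewrite amp_perm; congr (_ * _).
rewrite !entry_on_wires.
have -> : agree_off w [ffun i => x (s i)] [ffun i => y (s i)] =
    agree_off (s \o w) x y.
  apply/forallP/forallP => xy j; apply/implyP => jw; last first.
    rewrite !ffunE; have /implyP := xy (s j); apply; apply: contra jw.
    by case/codomP => i /perm_inj->; apply: codom_f.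
  have /implyP := xy ((s^-1)%g j); rewrite !ffunE permKV; apply.
  apply: contra jw => /codomP[i ij]; rewrite -(permKV s j) ij.
  exact: (codom_f (s \o w)).
by case: ifP => // _; congr entry; apply/ffunP => i; rewrite !ffunE.
Qed.

Lemma perm_tensor n (s : {perm 'I_n}) (h : 'I_n -> bool -> bool -> C)
    (psi : state R n) :
  perm_state s (tensor h *m psi) =
  tensor (fun j => h ((s^-1)%g j)) *m perm_state s psi.
Proof.
apply: stateP => x; rewrite amp_perm !amp_mul (sum_perm s).
apply: eq_bigr => y _; rewrite amp_perm !entry_tensor; congr (_ * _).
rewrite [RHS](reindex_inj (@perm_inj _ s)) /=.
by apply: eq_bigr => j _; rewrite !ffunE permK.
Qed.

Lemma insert_bit_at n (q : 'I_n.+1) b x : insert_bit q b x q = b.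
Proof. by rewrite ffunE unlift_none. Qed.

Lemma insert_bit_lift n (q : 'I_n.+1) b x i : insert_bit q b x (lift q i) = x i.
Proof. by rewrite ffunE liftK. Qed.

Lemma sum_insert n (q : 'I_n.+1) (F : bits n.+1 -> C) :
  \sum_x F x = \sum_(b : bool) \sum_(x : bits n) F (insert_bit q b x).
Proof.
rewrite pair_big /= (reindex (fun p => insert_bit q p.1 p.2)) //=.
exists (fun x : bits n.+1 => (x q, [ffun i => x (lift q i)])) => [[b x]|x] _ /=.
  rewrite insert_bit_at; congr pair; apply/ffunP => i.
  by rewrite ffunE insert_bit_lift.
apply/ffunP => j; rewrite ffunE; case: unliftP => [i ->|->] //.
by rewrite ffunE.
Qed.

Lemma amp_measure n (q : 'I_n.+1) b (psi : state R n.+1) x :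
  amp (measure_out q b psi) x = amp psi (insert_bit q b x).
Proof. exact: ampK. Qed.

Lemma measureZ n (q : 'I_n.+1) b c (psi : state R n.+1) :
  measure_out q b (c *: psi) = c *: measure_out q b psi.
Proof. by apply: stateP => x; rewrite ampZ !amp_measure ampZ. Qed.

(** Read from right to left, this carries a permutation of the remaining qubits back across the
    measurement: it is extended by fixing the measured qubit. *)
Lemma measure_perm n (q : 'I_n.+1) b (s : {perm 'I_n}) (psi : state R n.+1) :
  measure_out q b (perm_state (lift_perm q q s) psi) =
  perm_state s (measure_out q b psi).
Proof.
apply: stateP => x; rewrite amp_measure !amp_perm amp_measure; congr amp.
apply/ffunP => j; rewrite ffunE; case: (unliftP q j) => [i ->|->].
  by rewrite lift_perm_lift !insert_bit_lift ffunE.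
by rewrite lift_perm_id !insert_bit_at.
Qed.

Lemma measure_tensor n (q : 'I_n.+1) b (h : 'I_n.+1 -> bool -> bool -> C)
    (psi : state R n.+1) :
  measure_out q b (tensor h *m psi) =
  h q b true *: (tensor (fun i => h (lift q i)) *m measure_out q true psi) +
  h q b false *: (tensor (fun i => h (lift q i)) *m measure_out q false psi).
Proof.
apply: stateP => x; rewrite amp_measure amp_mul (sum_insert q) big_bool.
rewrite {3}/amp mxE -!/(amp _ _) !ampZ !amp_mul !mulr_sumr.
by congr (_ + _); apply: eq_bigr => y _;
  rewrite amp_measure !entry_tensor (bigD1_ord q) //= !insert_bit_at mulrA;
  congr (_ * _ * _); apply: eq_bigr => i _; rewrite !insert_bit_lift.
Qed.

Lemma sqnormE n (psi : state R n) : sqnorm psi = (psi ^t* *m psi) 0 0.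
Proof.
rewrite mxE /sqnorm [RHS](reindex enum_rank) /=; last first.
  by exists enum_val => z _; rewrite ?enum_rankK ?enum_valK.
by apply: eq_bigr => x _; rewrite !mxE normCK mulrC.
Qed.

Lemma sqnorm_ge0 n (psi : state R n) : 0 <= sqnorm psi.
Proof. by apply: sumr_ge0 => x _; rewrite exprn_ge0. Qed.

Lemma sqnorm0 n : sqnorm (0 : state R n) = 0.
Proof. by apply: big1 => x _; rewrite amp0 normr0 expr0n. Qed.

Lemma sqnorm_eq0 n (psi : state R n) : sqnorm psi = 0 -> psi = 0.
Proof.
move/eqP; rewrite psumr_eq0 => [|x _]; last by rewrite exprn_ge0.
move/allP => psi0; apply: stateP => x; rewrite amp0; apply/eqP.
by have := psi0 x (mem_index_enum x); rewrite /= sqrf_eq0 normr_eq0.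
Qed.

Lemma sqnorm_unitary n (U : oper R n) (psi : state R n) :
  U \is unitarymx -> sqnorm (U *m psi) = sqnorm psi.
Proof.
move=> /unitarymxP/mulmx1C UU; rewrite !sqnormE trmx_mul map_mxM /=.
by rewrite -mulmxA (mulmxA (U ^t*)) UU mul1mx.
Qed.

Lemma sqnorm_measure n (q : 'I_n.+1) (psi : state R n.+1) :
  sqnorm psi = sqnorm (measure_out q true psi) + sqnorm (measure_out q false psi).
Proof.
rewrite /sqnorm (sum_insert q) big_bool; congr (_ + _);
  by apply: eq_bigr => x _; rewrite amp_measure.
Qed.

Lemma sqnorm_zero_state n : sqnorm (zero_state R n) = 1.
Proof.
rewrite /sqnorm (bigD1 [ffun=> false]) //= ampK eqxx normr1 expr1n.
by rewrite big1 ?addr0 // => x /negPf x0; rewrite ampK x0 normr0 expr0n.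
Qed.

Lemma wires1_inj n (q : 'I_n) : injective (wires1 q).
Proof. by move=> i j _; rewrite !ord1. Qed.

Lemma wires2_inj n (p q : 'I_n) : p != q -> injective (wires2 p q).
Proof.
move=> pq i j; rewrite /wires2; case: i => [[|[|[]]] // hi]; case: j => [[|[|[]]] // hj];
  rewrite -!val_eqE /= => E; apply: val_inj => //=; by rewrite E eqxx in pq.
Qed.

(* Outcomes of probability zero, where the unnormalized state is 0, succeed. *)
Fixpoint succeeds n (G : set (state R n)) k (A : algo R n k) : state R k -> Prop :=
  match A in algo _ _ k return state R k -> Prop with
  | Stop => fun psi => psi = 0 \/ G psi
  | Measure _ q next => fun psi =>
      forall b, succeeds G (next b) (measure_out q b psi)
  | Gate1 _ q U _ next => fun psi =>
      succeeds G next (on_wires (wires1 q) U *m psi)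
  | Gate2 _ p q _ U _ next => fun psi =>
      succeeds G next (on_wires (wires2 p q) U *m psi)
  end.

Lemma success_prob_le n (G : set (state R n)) k (A : algo R n k) psi :
  success_prob G A psi <= sqnorm psi.
Proof.
elim: k / A psi =>
  [psi|k q next IH psi|k q U HU next IH psi|k p q pq U HU next IH psi] /=.
- by case: asboolP => // _; apply: sqnorm_ge0.
- by rewrite big_bool (sqnorm_measure q) lerD.
- by rewrite (le_trans (IH _)) // sqnorm_unitary // on_wires_unitary //;
    [apply: wires1_inj|case: HU].
by rewrite (le_trans (IH _)) // sqnorm_unitary // on_wires_unitary //;
  [apply: wires2_inj|case: HU].
Qed.

(** Gates preserve the squared norm and a measurement splits it between its outcomes, so no branch
    can make up for a loss in another one. *)
Lemma succeedsP n (G : set (state R n)) k (A : algo R n k) psi :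
  success_prob G A psi = sqnorm psi <-> succeeds G A psi.
Proof.
elim: k / A psi =>
  [psi|k q next IH psi|k q U HU next IH psi|k p q pq U HU next IH psi] /=.
- case: asboolP => [Gpsi|nG]; first by split=> // _; right.
  by split=> [/esym/sqnorm_eq0|[->|//]]; [left|rewrite sqnorm0].
- rewrite big_bool (sqnorm_measure q); split=> [E b|S]; last first.
    by congr (_ + _); apply/IH.
  have le b' := success_prob_le G (next b') (measure_out q b' psi).
  (* The deficits of the two outcomes are nonnegative and sum to zero, so each vanishes. *)
  have /andP[] : (sqnorm (measure_out q true psi) -
        success_prob G (next true) (measure_out q true psi) == 0) &&
      (sqnorm (measure_out q false psi) -
        success_prob G (next false) (measure_out q false psi) == 0).
    by rewrite -paddr_eq0 ?subr_ge0 // addrACA -opprD -E subrr.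
  by rewrite !subr_eq0 => /eqP/esym/IH St /eqP/esym/IH Sf; case: b.
- rewrite -(IH _) sqnorm_unitary // on_wires_unitary //;
    [exact: wires1_inj|by case: HU].
rewrite -(IH _) sqnorm_unitary // on_wires_unitary //;
  [exact: wires2_inj|by case: HU].
Qed.

(** The scalar may be 0, so an outcome of probability zero is covered by the same correction formula
    as any other. *)
Lemma succeedsZ n (G : set (state R n)) k (A : algo R n k) c psi :
  (forall a phi, G phi -> G (a *: phi)) ->
  succeeds G A psi -> succeeds G A (c *: psi).
Proof.
move=> GZ; elim: k / A psi =>
  [psi|k q next IH psi|k q U HU next IH psi|k p q pq U HU next IH psi] /=.
- by move=> [->|]; [rewrite scaler0; left|right; apply: GZ].
- by move=> S b; rewrite measureZ; apply: IH.
- by rewrite -scalemxAr; apply: IH.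
by rewrite -scalemxAr; apply: IH.
Qed.

End States.

(** * Stabilizer states *)

Section Stabilizer.
Variable R : realType.
Local Notation C := R[i].
Local Notation ptensor := (@ptensor R _).

(** Conjugation on labels, with any nonzero scalar: products and inverses then need no bookkeeping
    of phases. *)
Definition conjugates n (U : oper R n) (h g : 'I_n -> pauli) :=
  exists2 a : C, a != 0 & U *m ptensor h = a *: (ptensor g *m U).

Lemma conjugates_mul n (U V : oper R n) h g f :
  conjugates V h g -> conjugates U g f -> conjugates (U *m V) h f.
Proof.
move=> [a a0 E] [b b0 F]; exists (a * b); first by rewrite mulf_neq0.
by rewrite -mulmxA E -scalemxAr (mulmxA U) F -scalemxAl scalerA mulmxA.
Qed.

Lemma conjugates_pauli_mul n (U : oper R n) h g h' g' :
  conjugates U h g -> conjugates U h' g' ->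
  conjugates U (fun j => pauli_mul (h j) (h' j)) (fun j => pauli_mul (g j) (g' j)).
Proof.
move=> [a a0 E] [b b0 F].
have c0 := pauli_phase_prod_neq0 R h h'; have d0 := pauli_phase_prod_neq0 R g g'.
have := ptensor_mul R h h'; have := ptensor_mul R g g'.
set c := \prod_j _ in c0 *; set d := \prod_j _ in d0 *; move=> Eg Eh.
exists (a * b * d / c); first by rewrite !mulf_neq0 ?invr_eq0.
have -> : ptensor (fun j => pauli_mul (h j) (h' j)) =
    c^-1 *: (ptensor h *m ptensor h').
  by rewrite Eh scalerA mulVf // scale1r.
rewrite -scalemxAr mulmxA E -scalemxAl -(mulmxA _ U) F -scalemxAr mulmxA Eg.
by rewrite -scalemxAl !scalerA; congr (_ *: _); ring.
Qed.

Lemma conjugates_adj n (U : oper R n) h g : U \is unitarymx ->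
  conjugates U h g -> conjugates (U ^t*) g h.
Proof.
move=> /unitarymxP UU [a a0 E]; exists a^-1; rewrite ?invr_eq0 //.
have -> : ptensor g = a^-1 *: (U *m ptensor h *m U ^t*).
  by rewrite E -scalemxAl -mulmxA UU mulmx1 scalerA mulVf // scale1r.
by rewrite -scalemxAr !mulmxA (mulmx1C UU) mul1mx.
Qed.

Lemma clifford_conjugates n (U : oper R n) h : clifford U ->
  exists g, conjugates U h g.
Proof.
move=> /cliffordP[_ U1 _]; have [a [g [/phases_neq0 a0 E]]] := U1 h.
by exists g, a.
Qed.

Lemma clifford_conjugates_onto n (U : oper R n) g : clifford U ->
  exists h, conjugates U h g.
Proof.
move=> /cliffordP[_ _ U1]; have [a [h [/phases_neq0 a0 E]]] := U1 g.
by exists h, a.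
Qed.

Lemma conjugates_anticomm n (U : oper R n) h g h' g' : U \is unitarymx ->
  conjugates U h g -> conjugates U h' g' -> anticomm h h' = anticomm g g'.
Proof.
move=> /unitarymxP UU [a a0 E] [b b0 F].
have := congr1 (mulmx U) (ptensor_comm R h h').
rewrite -scalemxAr !mulmxA E F -!scalemxAl -!(mulmxA _ U) E F -!scalemxAr !mulmxA.
rewrite (ptensor_comm R g g') -scalemxAl !scalerA.
(* Both sides are multiples of [ptensor g' *m ptensor g *m U]; this factor turns them into multiples
   of the identity. The scalars are [a * b] up to sign, and a nonzero number differs from its
   opposite. *)
move=> /(congr1 (fun M => M *m U ^t* *m ptensor g *m ptensor g')).
rewrite -!scalemxAl -!(mulmxA _ U) UU mulmx1 -!(mulmxA _ (ptensor g)).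
rewrite (mulmxA (ptensor g)) ptensorK mul1mx ptensorK => /eqP.
rewrite -subr_eq0 -scalerBl scaler_eq0 (negPf (oper_neq0 _ _)) orbF.
case: (anticomm h h'); case: (anticomm g g') => //=;
  rewrite ?expr0 ?expr1 ?mul1r ?mulr1 ?mulrN1 ?mulN1r ?opprK.

- rewrite mulNr opprK [b * a]mulrC -mulr2n mulrn_eq0 /= mulf_eq0.
  by rewrite (negPf a0) (negPf b0).
rewrite mulrN [b * a]mulrC -opprD oppr_eq0 -mulr2n mulrn_eq0 /= mulf_eq0.
by rewrite (negPf a0) (negPf b0).
Qed.

Lemma conjugates_on_wires n k (w : 'I_k -> 'I_n) (U : oper R k) h g :
  injective w -> (forall j, j \notin codom w -> h j = g j) ->
  conjugates U (h \o w) (g \o w) -> conjugates (on_wires w U) h g.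
Proof.
move=> w_inj hg [a a0 E]; exists a => //.
by apply: on_wires_conj_tensor => // j jw; rewrite hg.
Qed.

Definition splice n k (w : 'I_k -> 'I_n) (h : 'I_n -> pauli) (g : 'I_k -> pauli) j :=
  if [pick i | w i == j] is Some i then g i else h j.

Lemma splice_in n k (w : 'I_k -> 'I_n) h g : injective w -> splice w h g \o w = g.
Proof.
move=> w_inj; apply/funext => i; rewrite /splice /=.
by case: pickP => [j /eqP/w_inj-> //|/(_ i)]; rewrite eqxx.
Qed.

Lemma splice_out n k (w : 'I_k -> 'I_n) h g j : j \notin codom w ->
  splice w h g j = h j.
Proof.
move=> jw; rewrite /splice; case: pickP => // i /eqP wi.
by rewrite -wi codom_f in jw.
Qed.

(* psi is a stabilizer state: a maximality condition on the group of Paulis of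
   which psi is an eigenvector. *)
Definition stabilized n (psi : state R n) := forall h,
  (exists l, ptensor h *m psi = l *: psi) \/
  (exists g l, [/\ ptensor g *m psi = l *: psi, l != 0 & anticomm g h]).

(** The Pauli [h] is pulled back through the gate, the dichotomy is applied there, and the
    eigenvector relation found is pushed forward; conjugation preserves anticommutation. *)
Lemma stabilized_on_wires n k (w : 'I_k -> 'I_n) (U : oper R k) (psi : state R n) :
  injective w -> clifford U -> stabilized psi -> stabilized (on_wires w U *m psi).
Proof.
move=> w_inj HU Hs h; have uU : on_wires w U \is unitarymx.
  by apply: on_wires_unitary => //; case: HU.
have [f0 Ef] := clifford_conjugates_onto (h \o w) HU.
have [a a0 E] : conjugates (on_wires w U) (splice w h f0) h.
  apply: conjugates_on_wires => //; last by rewrite splice_in.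
  by move=> j jw; rewrite splice_out.
have T l g g' : conjugates (on_wires w U) g g' -> ptensor g *m psi = l *: psi ->
    exists l', [/\ ptensor g' *m (on_wires w U *m psi) = l' *: (on_wires w U *m psi)
      & l != 0 -> l' != 0].
  move=> [b b0 F] Eg; exists (l / b); split; last first.
    by move=> l0; rewrite mulf_neq0 ?invr_eq0.
  have -> : ptensor g' *m (on_wires w U *m psi) =
      b^-1 *: (on_wires w U *m ptensor g *m psi).
    by rewrite F -scalemxAl scalerA mulVf // scale1r mulmxA.
  by rewrite -mulmxA Eg -scalemxAr scalerA mulrC.
have [[l El]|[g [l [El l0 ag]]]] := Hs (splice w h f0).
  by left; have [l' [El' _]] := T _ _ _ (ex_intro2 _ _ a a0 E) El; exists l'.
right; have [g0 Eg0] := clifford_conjugates (g \o w) HU.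
have Cg : conjugates (on_wires w U) g (splice w g g0).
  apply: conjugates_on_wires => //; last by rewrite splice_in.
  by move=> j jw; rewrite splice_out.
have [l' [El' l'0]] := T _ _ _ Cg El.
exists (splice w g g0), l'; split=> //; first exact: l'0.
by rewrite -(conjugates_anticomm uU Cg (ex_intro2 _ _ a a0 E)).
Qed.

Lemma anticomm_lift n (q : 'I_n.+1) g h :
  anticomm g h = anticomm1 (g q) (h q) (+) anticomm (g \o lift q) (h \o lift q).
Proof. by rewrite /anticomm (bigD1_ord q). Qed.

Lemma anticomm_mul n (f g h : 'I_n -> pauli) :
  anticomm (fun j => pauli_mul (f j) (g j)) h = anticomm f h (+) anticomm g h.
Proof. by rewrite -big_split; apply: eq_bigr => j _; apply: anticomm1_mul. Qed.

Lemma measure_ptensor_diag n (q : 'I_n.+1) b h (psi : state R n.+1) :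
  ~~ anticomm1 (h q) PauliZ -> exists2 a : C, a != 0 &
  measure_out q b (ptensor h *m psi) =
  a *: (ptensor (h \o lift q) *m measure_out q b psi).
Proof.
move=> hq; exists (pauli_mx R (h q) b b).
  by move: hq; case: (h q) => //= _; rewrite eqxx ?oner_eq0 ?signr_eq0.
rewrite measure_tensor; case: b; case: (h q) hq => //= _;
  by rewrite ?scale0r ?addr0 ?add0r.
Qed.

(** At [q] the factor is X or Y, which has zero diagonal, so each outcome is fed by the opposite
    one. *)
Lemma measure_ptensor_flip n (q : 'I_n.+1) b h (psi : state R n.+1) :
  anticomm1 (h q) PauliZ -> exists2 a : C, a != 0 &
  measure_out q b (ptensor h *m psi) =
  a *: (ptensor (h \o lift q) *m measure_out q (~~ b) psi).
Proof.
move=> hq; exists (pauli_mx R (h q) b (~~ b)).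
  by move: hq; case: (h q); case: b => //= _; rewrite ?oppr_eq0 ?neq0Ci ?oner_eq0.
rewrite measure_tensor; case: b; case: (h q) hq => //= _;
  by rewrite ?scale0r ?addr0 ?add0r.
Qed.

Definition insert_pauli n (q : 'I_n.+1) (p : pauli) (h : 'I_n -> pauli) j :=
  if unlift q j is Some i then h i else p.

Lemma insert_pauli_at n (q : 'I_n.+1) p h : insert_pauli q p h q = p.
Proof. by rewrite /insert_pauli unlift_none. Qed.

Lemma insert_pauli_lift n (q : 'I_n.+1) p h : insert_pauli q p h \o lift q = h.
Proof. by apply/funext => i; rewrite /insert_pauli /= liftK. Qed.

Lemma measure_eigen n (q : 'I_n.+1) b h l (psi : state R n.+1) :
  ~~ anticomm1 (h q) PauliZ -> ptensor h *m psi = l *: psi ->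
  exists l', ptensor (h \o lift q) *m measure_out q b psi = l' *: measure_out q b psi
    /\ (l != 0 -> l' != 0).
Proof.
move=> hq E; have [a a0] := measure_ptensor_diag b psi hq.
rewrite E measureZ => F; exists (a^-1 * l); split; last first.
  by move=> l0; rewrite mulf_neq0 ?invr_eq0.
by rewrite -scalerA F scalerA mulVf // scale1r.
Qed.

(** Only Paulis with I or Z at [q] survive the measurement. The dichotomy is applied to [h] extended
    by I and, if this yields a [g] with X or Y at [q], to [h] extended by Z. If that yields a [g']
    with X or Y at [q] as well, then off [q] the Pauli [g] anticommutes with [h] and [g'] commutes
    with it, so their product commutes with Z at [q] and still anticommutes with [h]. *)
Lemma stabilized_measure n (q : 'I_n.+1) b (psi : state R n.+1) :
  stabilized psi -> stabilized (measure_out q b psi).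
Proof.
move=> Hs h.
have I_diag p : ~~ anticomm1 p PauliZ -> forall l,
    ptensor (insert_pauli q p h) *m psi = l *: psi ->
    exists l, ptensor h *m measure_out q b psi = l *: measure_out q b psi.
  move=> pZ l E; have := @measure_eigen n q b (insert_pauli q p h) l psi.
  rewrite insert_pauli_at insert_pauli_lift => /(_ pZ E)[l' [E' _]].
  by exists l'.
have fin g l : ~~ anticomm1 (g q) PauliZ -> ptensor g *m psi = l *: psi ->
    l != 0 -> anticomm (g \o lift q) h ->
    (exists l, ptensor h *m measure_out q b psi = l *: measure_out q b psi) \/
    exists g l, [/\ ptensor g *m measure_out q b psi = l *: measure_out q b psi,
      l != 0 & anticomm g h].
  move=> gZ E l0 ag; right; have [l' [E' l'0]] := measure_eigen b gZ E.
  by exists (g \o lift q), l'; split; rewrite ?l'0.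
have [[l El]|[g [l [El l0]]]] := Hs (insert_pauli q PauliI h).
  by left; apply: I_diag El.
rewrite (anticomm_lift q) insert_pauli_at insert_pauli_lift.
have -> : anticomm1 (g q) PauliI = false by case: (g q).
rewrite addFb => ag.
have [gZ|gZ] := boolP (anticomm1 (g q) PauliZ); last exact: fin El l0 ag.
have [[l' El']|[g' [l' [El' l'0]]]] := Hs (insert_pauli q PauliZ h).
  by left; apply: I_diag El'.
rewrite (anticomm_lift q) insert_pauli_at insert_pauli_lift.
have [g'Z|g'Z] := boolP (anticomm1 (g' q) PauliZ); last exact: fin El' l'0.
rewrite addTb => ag'; pose f j := pauli_mul (g j) (g' j).
have d0 := pauli_phase_prod_neq0 R g g'; have Ed := ptensor_mul R g g'.
set d := \prod_j _ in d0 Ed.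
apply: (fin f (d^-1 * (l * l'))).
- by rewrite anticomm1_mul gZ g'Z.
- have -> : ptensor f = d^-1 *: (ptensor g *m ptensor g').
    by rewrite Ed scalerA mulVf // scale1r.
  by rewrite -scalemxAl -mulmxA El' -scalemxAr El !scalerA; congr (_ *: _); ring.
- by rewrite !mulf_neq0 ?invr_eq0.
by rewrite (anticomm_mul (g \o lift q) (g' \o lift q)) ag (negPf ag').
Qed.

(* Outcomes of a measurement of a stabilizer state agree up to a Pauli, unless
   one of them has probability zero (mu = 0). *)
Lemma measure_correction n (q : 'I_n.+1) (psi : state R n.+1) : stabilized psi ->
  exists b g mu,
    measure_out q (~~ b) psi = mu *: (ptensor g *m measure_out q b psi).
Proof.
move=> Hs; pose Zq := insert_pauli q PauliZ (fun=> PauliI).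
(* The dichotomy for Z at the measured qubit separates a determined outcome from a random one. *)
have [[l El]|[g [l [El l0]]]] := Hs Zq.
  have E (b : bool) : (-1) ^+ b *: measure_out q b psi = l *: measure_out q b psi.
    rewrite -measureZ -El measure_tensor /=.
    have -> : (fun i => pauli_mx R (Zq (lift q i))) = (fun i => pauli_mx R PauliI).
      by apply/funext => i; rewrite /Zq /insert_pauli liftK.
    rewrite /Zq insert_pauli_at [tensor _]ptensor1 !mul1mx.
    by case: b; rewrite /= scale0r ?addr0 ?add0r.
  have Z (b : bool) : l != (-1) ^+ b -> measure_out q b psi = 0.
    move=> lb; have /eqP := E b; rewrite -subr_eq0 -scalerBl scaler_eq0.
    by rewrite subr_eq0 eq_sym (negPf lb) => /eqP.
  (* Eigenvalue 1 excludes outcome [true]; any other eigenvalue excludes outcome [false]. *)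
  have [l1|l1] := eqVneq l 1.
    exists false, (fun=> PauliI), 0; rewrite scale0r Z // l1 expr1.
    by rewrite -subr_eq0 opprK -mulr2n mulrn_eq0 oner_eq0.
  by exists true, (fun=> PauliI), 0; rewrite scale0r Z.
(* Here [g] has X or Y at [q]. It fixes [psi] up to a scalar and exchanges the outcomes, so its
   restriction to the other qubits is the correction. *)
rewrite (anticomm_lift q) /Zq insert_pauli_at insert_pauli_lift.
rewrite [anticomm _ _]big1 ?addbF; last by move=> i _; case: (_ i).
move=> gZ; have [a a0] := measure_ptensor_flip true psi gZ.
rewrite El measureZ => F; exists false, (g \o lift q), (l^-1 * a).
by rewrite -scalerA -F scalerA mulVf // scale1r.
Qed.

Lemma ptensor_zero_state n (h : 'I_n -> pauli) :
  (forall j, ~~ anticomm1 (h j) PauliZ) ->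
  ptensor h *m zero_state R n = zero_state R n.
Proof.
move=> hZ; apply: stateP => x; rewrite amp_mul (bigD1 [ffun=> false]) //=.
rewrite [X in _ + X]big1 => [|y /negPf y0]; last by rewrite ampK y0 mulr0.
rewrite !ampK eqxx mulr1 addr0 entry_tensor.
case: eqP => [->|x0].
  rewrite big1 // => j _; rewrite !ffunE.
  by case: (h j) (hZ j) => //= _; rewrite eqxx ?expr0.
have [j xj] : exists j, x j.
  apply/existsP; apply: contra_notT x0; rewrite negb_exists => /forallP xF.
  by apply/ffunP => j; rewrite ffunE; apply/negbTE.
rewrite (bigD1 j) //= ffunE xj.
by case: (h j) (hZ j) => //= _; rewrite mul0r.
Qed.

Lemma stabilized_zero_state n : stabilized (zero_state R n).
Proof.
move=> h; have [[j hj]|nh] := EM (exists j, anticomm1 (h j) PauliZ).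
  right; exists (fun i => if i == j then PauliZ else PauliI), 1.
  rewrite scale1r oner_eq0; split=> //.
    by apply: ptensor_zero_state => i; case: ifP.
  rewrite /anticomm (bigD1 j) //= eqxx big1 => [|i /negPf->] //.
  by case: (h j) hj.
left; exists 1; rewrite scale1r; apply: ptensor_zero_state => j.
by apply/negP => hj; apply: nh; exists j.
Qed.

End Stabilizer.

(** * Clifford gates *)

Section Gates.
Variable R : realType.
Local Notation C := R[i].

Lemma on_wires_inj n k (w : 'I_k -> 'I_n) : injective w ->
  injective (@on_wires R n k w).
Proof.
move=> w_inj U V UV; apply: operP => u v.
pose x : bits n := [ffun=> false].
have := congr1 (fun M => entry M (overwrite w x u) (overwrite w x v)) UV.
rewrite !entry_on_wires agree_overwrite agree_off_sym agree_overwrite.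
rewrite !restrict_overwrite //.
have -> // : agree_off w x x.
by apply/forallP => j; rewrite eqxx implybT.
Qed.

Lemma on_wires_tensor n k (w : 'I_k -> 'I_n) (f : 'I_k -> bool -> bool -> C)
    (g : 'I_n -> bool -> bool -> C) : injective w ->
  (forall i a b, g (w i) a b = f i a b) ->
  (forall j, j \notin codom w -> g j = fun a b => (a == b)%:R) ->
  on_wires w (tensor f) = tensor g.
Proof.
move=> w_inj gw goff; apply: operP => x y.
rewrite entry_on_wires !entry_tensor (prod_wires _ w_inj).
under [X in _ = _ * X]eq_bigr => i _ do rewrite gw.
case: ifPn => [/forallP xy|].
  rewrite [X in _ = X * _]big1 ?mul1r; last first.
    by move=> j jw; have := xy j; rewrite jw goff //= => ->.
  by apply: eq_bigr => i _; rewrite !ffunE.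
rewrite negb_forall => /existsP[j]; rewrite negb_imply => /andP[jw /negPf xyj].
by rewrite (bigD1 j) //= goff // xyj !mul0r.
Qed.

Lemma on_wires_ptensor n k (w : 'I_k -> 'I_n) (g : 'I_k -> pauli) : injective w ->
  on_wires w (ptensor R g) = ptensor R (splice w (fun=> PauliI) g).
Proof.
move=> w_inj; apply: on_wires_tensor => // [i a b|j jw].
  by have := congr1 (fun f => f i) (splice_in (fun=> PauliI) g w_inj) => /= ->.
by rewrite splice_out.
Qed.

Definition bits2 (a b : bool) : bits 2 := [ffun i => if i == ord0 then a else b].

Lemma bits2E (x : bits 2) : x = bits2 (x ord0) (x ord_max).
Proof.
apply/ffunP => i; rewrite ffunE; case: eqP => [->//|i0]; congr (x _).
by apply: val_inj; case: i i0 => [[|[|]]] //= i12 []; apply: val_inj.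
Qed.

Lemma eq_bits2 a b c d : (bits2 a b == bits2 c d) = (a == c) && (b == d).
Proof.
apply/eqP/andP => [/ffunP E|[/eqP-> /eqP->]//].
by have := E ord0; have := E ord_max; rewrite !ffunE /= => -> ->.
Qed.

Lemma sum_bits2 (F : bits 2 -> C) :
  \sum_x F x = F (bits2 true true) + F (bits2 true false) +
    (F (bits2 false true) + F (bits2 false false)).
Proof.
rewrite (reindex (fun p => bits2 p.1 p.2)) /=.
  by rewrite -(pair_big predT predT (fun a b => F (bits2 a b))) /= !big_bool.
exists (fun x : bits 2 => (x ord0, x ord_max)) => [[a b]|x] _ /=.
  by rewrite !ffunE.
by rewrite -bits2E.
Qed.

Definition pair_pauli (p q : pauli) (i : 'I_2) := if i == ord0 then p else q.

Lemma pair_pauliE (h : 'I_2 -> pauli) : h = pair_pauli (h ord0) (h ord_max).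
Proof.
apply/funext => i; rewrite /pair_pauli; case: eqP => [->//|i0]; congr (h _).
by apply: val_inj; case: i i0 => [[|[|]]] //= i12 []; apply: val_inj.
Qed.

Lemma entry_pair p q a b c d :
  entry (ptensor R (pair_pauli p q)) (bits2 a b) (bits2 c d) =
  pauli_mx R p a c * pauli_mx R q b d.
Proof. by rewrite entry_tensor !big_ord_recl big_ord0 mulr1 !ffunE. Qed.

Lemma anticomm_pair p q p' q' :
  anticomm (pair_pauli p q) (pair_pauli p' q') = anticomm1 p p' (+) anticomm1 q q'.
Proof. by rewrite /anticomm !big_ord_recl big_ord0 addbF. Qed.

Lemma codom_wires1 n (q j : 'I_n) : (j \in codom (wires1 q)) = (j == q).
Proof.
apply/codomP/eqP => [[i ->]|->] //; by exists ord0.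
Qed.

Lemma codom_wires2 n (p q j : 'I_n) :
  (j \in codom (wires2 p q)) = (j == p) || (j == q).
Proof.
apply/codomP/orP => [[i ->]|[/eqP->|/eqP->]].
- by rewrite /wires2; case: ifP; rewrite eqxx; [left|right].
- by exists ord0.
by exists ord_max.
Qed.

Lemma ptensor_clifford n (h : 'I_n -> pauli) : clifford (ptensor R h).
Proof.
apply: clifford_involution; [exact: ptensor_adj|exact: ptensorK|].
move=> g; exists ((-1) ^+ anticomm h g), g; split; last exact: ptensor_comm.
by case: anticomm; rewrite !inE ?expr0 ?expr1 !eqxx ?orbT.
Qed.

(* (p + q) / sqrt 2, which for anticommuting p and q is the Clifford that swaps
   them under conjugation; for X and Z it is the Hadamard gate *)
Definition swap_pauli_mx p q a b : C :=
  (sqrtC 2)^-1 * (pauli_mx R p a b + pauli_mx R q a b).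

(** For anticommuting [p] and [q], multiplication by [pq] exchanges the two; I and the third Pauli
    keep their labels, the third one changing sign under conjugation. *)
Definition swap_pauli p q r :=
  if anticomm1 p r (+) anticomm1 q r then pauli_mul r (pauli_mul p q) else r.

Lemma sqrt2V : (sqrtC 2)^-1 * (sqrtC 2)^-1 * 2 = 1 :> C.
Proof.
by rewrite -invfM -expr2 sqrtCK mulVf // pnatr_eq0.
Qed.

Lemma swap_pauli_mxK p q a b : anticomm1 p q ->
  bool_mul (swap_pauli_mx p q) (swap_pauli_mx p q) a b = (a == b)%:R.
Proof.
have := sqrt2V; rewrite /swap_pauli_mx; set c := _^-1 => cc.
have i2 := sqrCi C.
by rewrite bool_mulE; case: p; case: q => //= _; case: a; case: b => /=;
  rewrite ?expr0 ?expr1; ring: i2 cc.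
Qed.

Lemma swap_pauli_mxE p q r a b : anticomm1 p q ->
  bool_mul (swap_pauli_mx p q) (pauli_mx R r) a b =
  (-1) ^+ (anticomm1 p r && anticomm1 q r) *
  bool_mul (pauli_mx R (swap_pauli p q r)) (swap_pauli_mx p q) a b.
Proof.
rewrite /swap_pauli_mx; set c := _^-1.
have i2 := sqrCi C.
by rewrite !bool_mulE; case: p; case: q => //= _; case: r; case: a; case: b => /=;
  rewrite ?expr0 ?expr1; ring: i2.
Qed.

Lemma swap_pauli_mx_adj p q a b : (swap_pauli_mx p q a b)^* = swap_pauli_mx p q b a.
Proof.
rewrite rmorphM rmorphD /= !pauli_mx_adj; congr (_ * _).
by rewrite conj_Creal // realV ger0_real // sqrtC_ge0 ler0n.
Qed.

(** Stated for any number of factors: one factor gives the gate, [n] factors the Hadamard layer that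
    prepares the graph state without edges. *)
Lemma swap_pauli_tensorK n p q : anticomm1 p q ->
  tensor (fun _ : 'I_n => swap_pauli_mx p q) *m tensor (fun=> swap_pauli_mx p q)
  = 1%:M.
Proof.
move=> pq; rewrite tensor_mul -ptensor1; apply: eq_tensor => j a b.
exact: swap_pauli_mxK.
Qed.

Lemma swap_pauli_tensor_adj n p q :
  (tensor (fun _ : 'I_n => swap_pauli_mx p q)) ^t* =
  tensor (fun=> swap_pauli_mx p q).
Proof.
apply: operP => x y; rewrite entry_adj !entry_tensor rmorph_prod.
by apply: eq_bigr => j _; apply: swap_pauli_mx_adj.
Qed.

Lemma swap_pauli_tensorE n p q (h : 'I_n -> pauli) : anticomm1 p q ->
  tensor (fun=> swap_pauli_mx p q) *m ptensor R h =
  (\prod_j (-1) ^+ (anticomm1 p (h j) && anticomm1 q (h j))) *: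
  (ptensor R (fun j => swap_pauli p q (h j)) *m tensor (fun=> swap_pauli_mx p q)).
Proof.
move=> pq; rewrite !tensor_mul -tensor_scale; apply: eq_tensor => j a b.
exact: swap_pauli_mxE.
Qed.

Definition swap_pauli_gate p q : oper R 1 := tensor (fun=> swap_pauli_mx p q).

Lemma swap_pauli_clifford p q : anticomm1 p q -> clifford (swap_pauli_gate p q).
Proof.
move=> pq; apply: clifford_involution.
- exact: swap_pauli_tensor_adj.
- exact: swap_pauli_tensorK.
move=> h; eexists _, (fun j => swap_pauli p q (h j)); split.
  2: exact: swap_pauli_tensorE.
by rewrite big_ord1; case: (_ && _); rewrite !inE ?expr0 ?expr1 !eqxx ?orbT.
Qed.

Lemma swap_pauli_conjugates p q r : anticomm1 p q ->
  conjugates (swap_pauli_gate p q) (fun=> r) (fun=> swap_pauli p q r).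
Proof.
move=> pq; eexists; last exact: (swap_pauli_tensorE (fun=> r) pq).
by apply/prodf_neq0 => j _; rewrite signr_eq0.
Qed.

(** Up to phase, [swap_pauli_gate] is a transposition of X, Y, Z. Each of the six ordered pairs is
    taken to (X, Z) by one or two transpositions, the pair (X, Z) itself by one transposition
    performed twice. *)
Lemma one_qubit_clifford p q : anticomm1 p q -> exists A : oper R 1,
  [/\ clifford A, conjugates A (fun=> p) (fun=> PauliX) &
      conjugates A (fun=> q) (fun=> PauliZ)].
Proof.
have S a b : anticomm1 a b -> swap_pauli a b p = PauliX ->
    swap_pauli a b q = PauliZ -> exists A : oper R 1,
    [/\ clifford A, conjugates A (fun=> p) (fun=> PauliX) &
      conjugates A (fun=> q) (fun=> PauliZ)].
  move=> ab pX qZ; exists (swap_pauli_gate a b); split.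
  - exact: swap_pauli_clifford.
  - by rewrite -pX; apply: swap_pauli_conjugates.
  by rewrite -qZ; apply: swap_pauli_conjugates.
have S2 a b c d : anticomm1 a b -> anticomm1 c d ->
    swap_pauli c d (swap_pauli a b p) = PauliX ->
    swap_pauli c d (swap_pauli a b q) = PauliZ -> exists A : oper R 1,
    [/\ clifford A, conjugates A (fun=> p) (fun=> PauliX) &
      conjugates A (fun=> q) (fun=> PauliZ)].
  move=> ab cd pX qZ; exists (swap_pauli_gate c d *m swap_pauli_gate a b); split.
  - by apply: clifford_mul; apply: swap_pauli_clifford.
  - by rewrite -pX; apply: conjugates_mul; apply: swap_pauli_conjugates.
  by rewrite -qZ; apply: conjugates_mul; apply: swap_pauli_conjugates.
case: p S S2; case: q => //= S S2 _.
- exact: (S PauliY PauliZ).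
- exact: (S2 PauliX PauliZ PauliX PauliZ).
- exact: (S2 PauliX PauliY PauliY PauliZ).
- exact: (S PauliX PauliY).
- exact: (S PauliX PauliZ).
exact: (S2 PauliY PauliZ PauliX PauliY).
Qed.

Lemma conjugates_first (A : oper R 1) p p' q :
  conjugates A (fun=> p) (fun=> p') ->
  conjugates (on_wires (wires1 ord0) A) (pair_pauli p q) (pair_pauli p' q).
Proof.
move=> A1; apply: conjugates_on_wires => //; first exact: wires1_inj.
by move=> j; rewrite codom_wires1 /pair_pauli => /negPf->.
Qed.

Lemma conjugates_second (A : oper R 1) p q q' :
  conjugates A (fun=> q) (fun=> q') ->
  conjugates (on_wires (wires1 ord_max) A) (pair_pauli p q) (pair_pauli p q').
Proof.
move=> A1; apply: conjugates_on_wires => //; first exact: wires1_inj.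
move=> j; rewrite codom_wires1 /pair_pauli => jm; case: (j =P ord0) => // j0.
case/eqP: jm; apply: val_inj; case: j j0 => [[|[|]]] //= i12 [].
exact: val_inj.
Qed.

Lemma entry_cz a b c d : entry (cz_gate R) (bits2 a b) (bits2 c d) =
  if (a == c) && (b == d) then (-1) ^+ (a && b) else 0.
Proof.
by rewrite entryK eq_bits2 !ffunE.
Qed.

Definition cz_sign p q : C :=
  match p, q with PauliX, PauliY | PauliY, PauliX => -1 | _, _ => 1 end.

(** Conjugation by CZ attaches a Z to a qubit whenever the other carries X or Y; since CZ is
    symmetric, the second factor is obtained by exchanging the arguments. *)
Definition cz_left p q := if anticomm1 q PauliZ then pauli_mul p PauliZ else p.

Lemma cz_pair p q : cz_gate R *m ptensor R (pair_pauli p q) =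
  cz_sign p q *: (ptensor R (pair_pauli (cz_left p q) (cz_left q p)) *m cz_gate R).
Proof.
have i2 := sqrCi C.
apply: operP => x y; rewrite (bits2E x) (bits2E y) entryZ !entry_mul !sum_bits2.
rewrite !entry_cz !entry_pair.
case: (x ord0); case: (x ord_max); case: (y ord0); case: (y ord_max);
  case: p; case: q => /=; rewrite ?expr0 ?expr1; by ring: i2.
Qed.

Lemma cz_conjugates p q : conjugates (cz_gate R)
  (pair_pauli p q) (pair_pauli (cz_left p q) (cz_left q p)).
Proof.
exists (cz_sign p q); last exact: cz_pair.
by case: p; case: q; rewrite /= ?oppr_eq0 oner_eq0.
Qed.

Lemma cz_adj : (cz_gate R) ^t* = cz_gate R.
Proof.
apply: operP => x y; rewrite entry_adj !entryK eq_sym.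
by case: eqP => [->|_]; rewrite ?conjC0 // rmorphXn /= rmorphN1.
Qed.

Lemma cz_clifford : clifford (cz_gate R).
Proof.
apply: clifford_involution.
- exact: cz_adj.
- apply: operP => x y; rewrite (bits2E x) (bits2E y) entry1 entry_mul sum_bits2.
  rewrite !entry_cz eq_bits2.
  case: (x ord0); case: (x ord_max); case: (y ord0); case: (y ord_max) => /=;
    rewrite ?expr0 ?expr1; by ring.
move=> h; rewrite (pair_pauliE h).
eexists _, _; split; last exact: cz_pair.
by case: (h ord0); case: (h ord_max); rewrite !inE eqxx ?orbT.
Qed.

Definition swap_gate : oper R 2 :=
  mkoper (fun x y => ((x ord0 == y ord_max) && (x ord_max == y ord0))%:R).

Lemma entry_swap a b c d : entry swap_gate (bits2 a b) (bits2 c d) =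
  ((a == d) && (b == c))%:R.
Proof. by rewrite entryK !ffunE. Qed.

Lemma swap_pair p q : swap_gate *m ptensor R (pair_pauli p q) =
  ptensor R (pair_pauli q p) *m swap_gate.
Proof.
apply: operP => x y; rewrite (bits2E x) (bits2E y) !entry_mul !sum_bits2.
rewrite !entry_swap !entry_pair.
case: (x ord0); case: (x ord_max); case: (y ord0); case: (y ord_max) => /=; by ring.
Qed.

Lemma swapK : swap_gate *m swap_gate = 1%:M.
Proof.
apply: operP => x y; rewrite (bits2E x) (bits2E y) entry1 entry_mul sum_bits2.
rewrite !entry_swap eq_bits2.
case: (x ord0); case: (x ord_max); case: (y ord0); case: (y ord_max) => /=; by ring.
Qed.

Lemma swap_clifford : clifford swap_gate.
Proof.
apply: clifford_involution; last 1 first.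
- move=> h; rewrite (pair_pauliE h); exists 1, (pair_pauli (h ord_max) (h ord0)).
  by rewrite inE eqxx scale1r swap_pair.
- apply: operP => x y; rewrite entry_adj !entryK andbC [x ord0 == _]eq_sym.
  by rewrite [x ord_max == _]eq_sym conjC_nat.
exact: swapK.
Qed.

Lemma swap_on_wires n (p q : 'I_n) (psi : state R n) : p != q ->
  on_wires (wires2 p q) swap_gate *m psi = perm_state (tperm p q) psi.
Proof.
move=> pq; apply: stateP => x; rewrite amp_mul amp_perm.
pose z : bits n := [ffun i => x (tperm p q i)].
have E y : entry (on_wires (wires2 p q) swap_gate) x y = (y == z)%:R.
  rewrite entry_on_wires entryK !ffunE /wires2 /=; case: ifPn => [/forallP xy|].
    congr (nat_of_bool _)%:R; apply/andP/eqP => [[/eqP xp /eqP xq]|->].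
      apply/ffunP => j; rewrite ffunE; case: tpermP => [->|->|/eqP jp /eqP jq] //.
      have := xy j; rewrite codom_wires2 negb_or jp jq /= => /eqP->//.
    by rewrite !ffunE tpermL tpermR !eqxx.
  move=> nxy; case: eqP => // yz; case/negP: nxy; apply/forallP => j.
  rewrite codom_wires2 negb_or; apply/implyP => /andP[jp jq].
  by rewrite yz ffunE tpermD // eq_sym.
rewrite (bigD1 z) //= E eqxx mul1r big1 ?addr0 // => y /negPf yz.
by rewrite E yz mul0r.
Qed.

End Gates.

(** * Two-qubit Clifford operations *)

Section Simulation.
Variable R : realType.
Local Notation C := R[i].
Local Notation first := (wires1 (ord0 : 'I_2)).
Local Notation second := (wires1 (ord_max : 'I_2)).

(** An upper bound [m] for the cost of [U] in front of an already converted continuation. The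
    permutation may change from [s] to [s'], which makes swaps free, and quantifying over all
    continuations lets the bounds add up for products. *)
Definition simulable m (U : oper R 2) := forall n (G : set (state R n)) k
    (p q : 'I_k) (A : algo R n k) (s : {perm 'I_k}) (psi : state R k),
  p != q -> only_cz A ->
  succeeds G A (perm_state s (on_wires (wires2 p q) U *m psi)) ->
  exists (s' : {perm 'I_k}) (A' : algo R n k),
    [/\ only_cz A', (cz_complexity A' <= m + cz_complexity A)%N &
        succeeds G A' (perm_state s' psi)].

Lemma simulable_leq m m' U : (m <= m')%N -> simulable m U -> simulable m' U.
Proof.
move=> mm' S n G k p q A s psi pq Acz SA.
have [s' [A' [? le ?]]] := S _ _ _ _ _ _ _ _ pq Acz SA.
by exists s', A'; split=> //; rewrite (leq_trans le) // leq_add2r.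
Qed.

Lemma simulable_mul m m' U V : simulable m U -> simulable m' V ->
  simulable (m + m') (U *m V).
Proof.
move=> SU SV n G k p q A s psi pq Acz.
rewrite on_wires_mul; last exact: wires2_inj.
rewrite -mulmxA => /(SU _ _ _ _ _ _ _ _ pq Acz)[s' [A' [A'cz le]]].
move=> /(SV _ _ _ _ _ _ _ _ pq A'cz)[s'' [A'' [? le' ?]]].
exists s'', A''; split=> //.
by rewrite (leq_trans le') // -addnA addnCA leq_add2l.
Qed.

Lemma simulable_local (i : 'I_2) (A : oper R 1) : clifford A ->
  simulable 0 (on_wires (wires1 i) A).
Proof.
move=> HA n G k p q B s psi pq Bcz.
rewrite on_wires_comp; last exact: wires2_inj.
rewrite perm_on_wires => SB.
by exists s, (Gate1 (s (wires2 p q i)) HA B).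
Qed.

Lemma simulable_cz : simulable 1 (cz_gate R).
Proof.
move=> n G k p q B s psi pq Bcz; rewrite perm_on_wires => SB.
have spq : s p != s q by rewrite (inj_eq (@perm_inj _ s)).
exists s, (Gate2 spq (cz_clifford R) B); split=> //=.
have <- // : s \o wires2 p q = wires2 (s p) (s q).
by apply/funext => j; rewrite /wires2 /=; case: eqP.
Qed.

Lemma simulable_swap : simulable 0 (swap_gate R).
Proof.
move=> n G k p q B s psi pq Bcz; rewrite swap_on_wires // perm_stateM => SB.
by exists (tperm p q * s)%g, B.
Qed.

Lemma ptensor_second q : on_wires second (ptensor R (fun=> q)) =
  ptensor R (pair_pauli PauliI q).
Proof.
rewrite on_wires_ptensor; last exact: wires1_inj.
rewrite [splice _ _ _]pair_pauliE; congr (ptensor R (pair_pauli _ _)).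
  by rewrite splice_out // codom_wires1.
have E := splice_in (fun=> PauliI) (fun=> q) (@wires1_inj 2 ord_max).
exact: (congr1 (fun f => f ord0) E).
Qed.

Lemma ptensor_first p : on_wires first (ptensor R (fun=> p)) =
  ptensor R (pair_pauli p PauliI).
Proof.
rewrite on_wires_ptensor; last exact: wires1_inj.
rewrite [splice _ _ _]pair_pauliE; congr (ptensor R (pair_pauli _ _)).
  have E := splice_in (fun=> PauliI) (fun=> p) (@wires1_inj 2 ord0).
  exact: (congr1 (fun f => f ord0) E).
by rewrite splice_out // codom_wires1.
Qed.

(* Schur's lemma for the irreducible action of X and Z on the first qubit *)
Lemma commutant_first (V : oper R 2) :
  V *m ptensor R (pair_pauli PauliX PauliI) =
    ptensor R (pair_pauli PauliX PauliI) *m V ->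
  V *m ptensor R (pair_pauli PauliZ PauliI) =
    ptensor R (pair_pauli PauliZ PauliI) *m V ->
  exists D : oper R 1, V = on_wires second D.
Proof.
move=> VX VZ.
(* With respect to the first bit, [V] will be block diagonal with equal blocks; [D] is the block
   where this bit is 0. Commutation with X makes the blocks equal. *)
exists (mkoper (fun x y => entry V (bits2 false (x ord0)) (bits2 false (y ord0)))).
have EX a b c d : entry V (bits2 a b) (bits2 (~~ c) d) =
    entry V (bits2 (~~ a) b) (bits2 c d).
  have := congr1 (fun M => entry M (bits2 a b) (bits2 c d)) VX.
  rewrite /= !entry_mul !sum_bits2 !entry_pair.
  by case: a; case: b; case: c; case: d;
    rewrite /= !(mul0r, mulr0, mul1r, mulr1, addr0, add0r).
have opp_fix (v : C) : (v = - v) \/ (- v = v) -> v = 0.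
  move=> E; have /eqP : v = - v by case: E.
  by rewrite -subr_eq0 opprK -mulr2n mulrn_eq0 => /eqP.
(* Commutation with Z equates each entry of an off-diagonal block with its opposite. *)
have EZ a b d : entry V (bits2 a b) (bits2 (~~ a) d) = 0.
  have := congr1 (fun M => entry M (bits2 a b) (bits2 (~~ a) d)) VZ.
  rewrite /= !entry_mul !sum_bits2 !entry_pair.
  by case: a; case: b; case: d; rewrite /= !(mul0r, mulr0, mul1r, mulr1, addr0,
    add0r, expr0, expr1, mulrN1, mulN1r) => E; apply: opp_fix; auto.
apply: operP => x y; rewrite (bits2E x) (bits2E y).
rewrite entry_on_wires entryK !ffunE /=.
have -> : agree_off second (bits2 (x ord0) (x ord_max)) (bits2 (y ord0) (y ord_max))
    = (x ord0 == y ord0).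
  apply/forallP/idP => [/(_ ord0)|/eqP xy j]; first by rewrite codom_wires1 !ffunE.
  rewrite codom_wires1 !ffunE xy; case: (j =P ord0) => [->|j0].
    by rewrite eqxx implybT.
  have -> : j = ord_max; last by rewrite eqxx.
  apply: val_inj; case: j j0 => [[|[|]]] //= i12 []; exact: val_inj.
case: eqP => [<-|xy]; first by case: (x ord0) => //; exact: (EX true _ false).
have -> : y ord0 = ~~ x ord0 by case: (x ord0) xy; case: (y ord0).
exact: EZ.
Qed.

(** Since I⊗D fixes every Pauli of the form p⊗I, the image or preimage of I⊗h commutes with all of
    these. Its first factor is therefore I, and its second factor serves for [D]. *)
Lemma clifford_second (D : oper R 1) :
  clifford (on_wires second D) -> clifford D.
Proof.
move=> HV; have w_inj := @wires1_inj 2 ord_max; have oi := on_wires_inj w_inj.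
have [uV V1 V2] := (cliffordP _).1 HV.
have CI p : conjugates (on_wires second D) (pair_pauli p PauliI) (pair_pauli p PauliI).
  apply: conjugates_second; exists 1; rewrite ?oner_eq0 //.
  by rewrite [ptensor _ _]ptensor1 scale1r mulmx1 mul1mx.
have pauliI p : anticomm1 p PauliX = false -> anticomm1 p PauliZ = false ->
  p = PauliI by case: p.
have fun1 (h : 'I_1 -> pauli) : h = fun=> h ord0.
  by apply/funext => i; rewrite ord1.
apply/cliffordP; split.
- apply/unitarymxP/oi; rewrite on_wires_mul // on_wires1 // -on_wires_adj.
  exact/unitarymxP.
- move=> h; have [a [g [ap E]]] := V1 (pair_pauli PauliI (h ord0)).
  have Cg : conjugates (on_wires second D) (pair_pauli PauliI (h ord0))
      (pair_pauli (g ord0) (g ord_max)).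
    by rewrite -pair_pauliE; exists a; first exact: phases_neq0.
  have g0 : g ord0 = PauliI.
    have g0 p : anticomm1 (g ord0) p = false.
      have := conjugates_anticomm uV Cg (CI p).
      by rewrite !anticomm_pair; case: (g ord_max); case: (h ord0); rewrite /= addbF.
    exact: pauliI.
  exists a, (fun=> g ord_max); split=> //; apply: oi.
  move: E; rewrite (pair_pauliE g) g0 -!ptensor_second -!on_wires_mul // -fun1 => ->.
  apply: operP => x y; rewrite entryZ !entry_on_wires entryZ.
  by case: ifP => // _; rewrite mulr0.
move=> h; have [a [g [ap E]]] := V2 (pair_pauli PauliI (h ord0)).
have Cg : conjugates (on_wires second D) (pair_pauli (g ord0) (g ord_max))
    (pair_pauli PauliI (h ord0)).
  by rewrite -pair_pauliE; exists a; first exact: phases_neq0.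
have g0 : g ord0 = PauliI.
  have g0 p : anticomm1 (g ord0) p = false.
    have := conjugates_anticomm uV Cg (CI p).
    by rewrite !anticomm_pair; case: (g ord_max); case: (h ord0); rewrite /= addbF.
  exact: pauliI.
exists a, (fun=> g ord_max); split=> //; apply: oi.
move: E; rewrite (pair_pauliE g) g0 -!ptensor_second -!on_wires_mul // -fun1 => ->.
apply: operP => x y; rewrite entryZ !entry_on_wires entryZ.
by case: ifP => // _; rewrite mulr0.
Qed.

(** As [ptensor h] squares to the identity, so does its conjugate; hence the scalar squares to 1. *)
Lemma conjugates_sign n (U : oper R n) h : U \is unitarymx -> conjugates U h h ->
  exists s : bool, U *m ptensor R h = (-1) ^+ s *: (ptensor R h *m U).
Proof.
move=> /unitarymxP UU [a a0 E].
have : a * a = 1.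
  have := congr1 (fun M => M *m ptensor R h) E.
  rewrite /= -mulmxA ptensorK mulmx1 -scalemxAl -mulmxA E -scalemxAr mulmxA.
  rewrite ptensorK mul1mx scalerA => /(congr1 (fun M => M *m U ^t*)).
  rewrite -scalemxAl UU => /eqP; rewrite -subr_eq0 -{1}[1%:M]scale1r -scalerBl.
  by rewrite scaler_eq0 (negPf (oper_neq0 _ _)) orbF subr_eq0 => /eqP.
rewrite -expr2 => /eqP; rewrite sqrf_eq1 => /orP[]/eqP a1.
  by exists false; rewrite E a1 expr0.
by exists true; rewrite E a1 expr1.
Qed.

Lemma simulable_fixing_first (U : oper R 2) : clifford U ->
  conjugates U (pair_pauli PauliX PauliI) (pair_pauli PauliX PauliI) ->
  conjugates U (pair_pauli PauliZ PauliI) (pair_pauli PauliZ PauliI) ->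
  simulable 0 U.
Proof.
move=> HU; have uU : U \is unitarymx by case: HU.
move=> /(conjugates_sign uU)[s EX] /(conjugates_sign uU)[t EZ].
(* The four Paulis realize the four pairs of signs; composing with [p] on the first qubit cancels
   the signs and leaves an operator in the commutant of that qubit. *)
have [p [pX pZ]] : exists p, anticomm1 p PauliX = s /\ anticomm1 p PauliZ = t.
  case: (s) (t) => [] []; [exists PauliY|exists PauliZ|exists PauliX|exists PauliI];
  by [].
pose P := ptensor R (pair_pauli p PauliI).
have EPU : U = P *m (P *m U) by rewrite mulmxA ptensorK mul1mx.
have C q b : anticomm1 p q = b ->
    U *m ptensor R (pair_pauli q PauliI) =
      (-1) ^+ b *: (ptensor R (pair_pauli q PauliI) *m U) ->
    P *m U *m ptensor R (pair_pauli q PauliI) =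
      ptensor R (pair_pauli q PauliI) *m (P *m U).
  move=> pq E; rewrite -mulmxA E -scalemxAr !mulmxA ptensor_comm anticomm_pair pq.
  by rewrite addbF -scalemxAl scalerA -signr_addb addbb expr0 scale1r.
have [D ED] := commutant_first (C _ _ pX EX) (C _ _ pZ EZ).
have HD : clifford D.
  apply: clifford_second; rewrite -ED; apply: clifford_mul => //.
  exact: ptensor_clifford.
rewrite EPU ED /P -ptensor_first; apply: (@simulable_mul 0 0).
  by apply: simulable_local; apply: ptensor_clifford.
exact: simulable_local.
Qed.

Lemma clifford_on_wires n k (w : 'I_k -> 'I_n) (A : oper R k) : injective w ->
  clifford A -> clifford (on_wires w A).
Proof.
move=> w_inj HA; have [uA A1 A2] := (cliffordP _).1 HA.
apply/cliffordP; split; first exact: on_wires_unitary.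
  move=> h; have [a [g [ap E]]] := A1 (h \o w).
  exists a, (splice w h g); split=> //; apply: on_wires_conj_tensor => //.
    by move=> j jw; rewrite splice_out.
  move: E; rewrite -{1}(splice_in h g w_inj); exact.
move=> h; have [a [g [ap E]]] := A2 (h \o w).
exists a, (splice w h g); split=> //; apply: on_wires_conj_tensor => //.
  by move=> j jw; rewrite splice_out.
move: E; rewrite -{1}(splice_in h g w_inj); exact.
Qed.

Lemma unitary_mulKl n (A B : oper R n) : A \is unitarymx -> B = A ^t* *m (A *m B).
Proof. by move=> /unitarymxP/mulmx1C AA; rewrite mulmxA AA mul1mx. Qed.

Lemma unitary_mulKr n (A B : oper R n) : A \is unitarymx -> B = B *m A ^t* *m A.
Proof. by move=> /unitarymxP/mulmx1C AA; rewrite -mulmxA AA mulmx1. Qed.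

(** Gates on the first qubit turn both (a, b) and (p, q) into (X, Z), so [W] fixes Z⊗I and sends X⊗I
    to X⊗r. If [r] is I, then [W] is local; otherwise [r] is rotated to Z, and CZ takes X⊗Z back to
    X⊗I while keeping Z⊗I. *)
Lemma simulable_cz_class (U : oper R 2) a b p q r : clifford U ->
  anticomm1 a b ->
  conjugates U (pair_pauli a PauliI) (pair_pauli p r) ->
  conjugates U (pair_pauli b PauliI) (pair_pauli q PauliI) ->
  simulable 1 U.
Proof.
move=> HU ab Ua Ub; have uU : U \is unitarymx by case: HU.
have pq : anticomm1 p q.
  have := conjugates_anticomm uU Ua Ub; rewrite !anticomm_pair ab.
  by case: r {Ua}; rewrite /= addbF => <-.
have [A [HA Aa Ab]] := one_qubit_clifford R ab.
have [B [HB Bp Bq]] := one_qubit_clifford R pq.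
have w0 := @wires1_inj 2 ord0; have w1 := @wires1_inj 2 ord_max.
have uA : A \is unitarymx by case: HA.
have uB : B \is unitarymx by case: HB.
pose A0 := on_wires first A; pose B0 := on_wires first B.
pose W := B0 *m (U *m A0 ^t*).
have HW : clifford W.
  apply: clifford_mul; first exact: clifford_on_wires.
  by apply: clifford_mul => //; apply: clifford_adj; apply: clifford_on_wires.
have uA0 : A0 \is unitarymx by apply: on_wires_unitary.
have uB0 : B0 \is unitarymx by apply: on_wires_unitary.
have WX : conjugates W (pair_pauli PauliX PauliI) (pair_pauli PauliX r).
  apply: conjugates_mul (conjugates_first _ Bp).
  by apply: conjugates_mul Ua; apply: conjugates_adj => //; apply: conjugates_first.
have WZ : conjugates W (pair_pauli PauliZ PauliI) (pair_pauli PauliZ PauliI).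
  apply: conjugates_mul (conjugates_first _ Bq).
  by apply: conjugates_mul Ub; apply: conjugates_adj => //; apply: conjugates_first.
have -> : U = B0 ^t* *m (W *m A0).
  by rewrite /W -!mulmxA -unitary_mulKl // mulmxA -unitary_mulKr.
have SW : simulable 1 W.
  have [r1|[t tr]] : r = PauliI \/ exists t, anticomm1 t r.
    by case: (r); [left|right; exists PauliY|right; exists PauliX|right; exists PauliX].
    by rewrite r1 in WX; apply: (simulable_leq (leq0n 1)); apply: simulable_fixing_first.
  (* The partner [t] completes [r] to an anticommuting pair, so that [D] can send [r] to Z. *)
  have [D [HD _ Dr]] := one_qubit_clifford R tr.
  have uD : on_wires second D \is unitarymx by apply: on_wires_unitary; case: HD.
  have ucz : cz_gate R \is unitarymx by case: (cz_clifford R).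
  rewrite (unitary_mulKl W uD) on_wires_adj.
  apply: (@simulable_mul 0 1); first by apply: simulable_local; apply: clifford_adj.
  have czadj : (cz_gate R) ^t* = cz_gate R by apply: cz_adj.
  rewrite (unitary_mulKl (_ *m W) ucz) czadj.
  apply: (@simulable_mul 1 0); first exact: simulable_cz.
  apply: simulable_fixing_first.
  - apply: clifford_mul; first exact: cz_clifford.
    by apply: clifford_mul => //; apply: clifford_on_wires.
  - apply: (@conjugates_mul _ _ _ _ _ (pair_pauli PauliX PauliZ)).
      by apply: conjugates_mul WX _; apply: conjugates_second.
    exact: (cz_conjugates R PauliX PauliZ).
  apply: (@conjugates_mul _ _ _ _ _ (pair_pauli PauliZ PauliI)).
    apply: conjugates_mul WZ _; apply: conjugates_second.
    exists 1; rewrite ?oner_eq0 //.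
    by rewrite [ptensor _ _]ptensor1 scale1r mulmx1 mul1mx.
  exact: (cz_conjugates R PauliZ PauliI).
rewrite /B0 /A0 on_wires_adj; apply: (@simulable_mul 0 1).
  by apply: simulable_local; apply: clifford_adj.
by apply: (@simulable_mul 1 0) => //; apply: simulable_local.
Qed.

(** The images of X⊗I and Z⊗I anticommute, so their factors anticommute on exactly one qubit, the
    first one after a swap if necessary. The factors on the second qubit then commute: one of them
    is I, or they are equal. In each case the image of Z⊗I, X⊗I or Y⊗I is trivial on the second
    qubit, as [simulable_cz_class] requires. *)
Lemma simulable_clifford (U : oper R 2) : clifford U -> simulable 1 U.
Proof.
have noswap V f g : clifford V ->
    conjugates V (pair_pauli PauliX PauliI) f ->
    conjugates V (pair_pauli PauliZ PauliI) g ->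
    anticomm1 (f ord0) (g ord0) -> simulable 1 V.
  move=> HV VX VZ fg; have uV : V \is unitarymx by case: HV.
  have := conjugates_anticomm uV VX VZ.
  have VY := conjugates_pauli_mul VX VZ; move: VX VZ VY.
  rewrite (pair_pauliE f) (pair_pauliE g) !anticomm_pair /= fg.
  move: (f ord0) (f ord_max) (g ord0) (g ord_max) => p p' q q' VX VZ VY.
  have [q1|q1] : q' = PauliI \/ q' <> PauliI by case: (q'); [left|right..].
    by move=> _; rewrite q1 in VZ; apply: simulable_cz_class VX VZ.
  have [p1|p1] : p' = PauliI \/ p' <> PauliI by case: (p'); [left|right..].
    by move=> _; rewrite p1 in VX; apply: simulable_cz_class VZ VX.
  (* Commuting Paulis other than I are equal, so they cancel in the image of Y⊗I, which takes the
     place of Z⊗I. *)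
  move=> pq; have E : p' = q' by move: p1 q1 pq; case: (p'); case: (q').
  apply: (@simulable_cz_class _ PauliX PauliY p (pauli_mul p q) p') => //.
  move: VY; rewrite E; set h := (fun j => _); set k := (fun j => _).
  rewrite (pair_pauliE h) (pair_pauliE k) /h /k /=.
  by have -> : pauli_mul q' q' = PauliI by case: (q').
move=> HU; have uU : U \is unitarymx by case: HU.
have [f Uf] := clifford_conjugates (pair_pauli PauliX PauliI) HU.
have [g Ug] := clifford_conjugates (pair_pauli PauliZ PauliI) HU.
have [fg|fg] := boolP (anticomm1 (f ord0) (g ord0)); first exact: noswap fg.
have fg' : anticomm1 (f ord_max) (g ord_max).
  have := conjugates_anticomm uU Uf Ug.
  by rewrite (pair_pauliE f) (pair_pauliE g) !anticomm_pair (negPf fg) addFb => <-.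
have swap_conj h : conjugates (swap_gate R) h (pair_pauli (h ord_max) (h ord0)).
  exists 1; rewrite ?oner_eq0 // scale1r -swap_pair -pair_pauliE //.
have -> : U = swap_gate R *m (swap_gate R *m U) by rewrite mulmxA swapK mul1mx.
apply: (@simulable_mul 0 1); first exact: simulable_swap.
apply: noswap (conjugates_mul Uf (swap_conj f)) (conjugates_mul Ug (swap_conj g)) _ => //.
by apply: clifford_mul => //; apply: swap_clifford.
Qed.

End Simulation.

(** * Conversion of algorithms *)

Section Conversion.
Variable R : realType.
Local Notation C := R[i].

(** A tensor of one-qubit Cliffords is a sequence of free gates, built qubit by qubit along a list.
    It serves for the Pauli corrections and for the initial Hadamard layer. *)
Lemma local_layer n (G : set (state R n)) k (A : algo R n k)
    (f : 'I_k -> bool -> bool -> C) :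
  (forall j, clifford (tensor (fun _ : 'I_1 => f j))) ->
  exists A' : algo R n k,
    [/\ only_cz A -> only_cz A', cz_complexity A' = cz_complexity A &
    forall psi, succeeds G A (tensor f *m psi) -> succeeds G A' psi].
Proof.
move=> Hf.
pose g (s : seq 'I_k) j (a b : bool) : C := if j \in s then f j a b else (a == b)%:R.
have layer s : uniq s -> exists A' : algo R n k,
    [/\ only_cz A -> only_cz A', cz_complexity A' = cz_complexity A &
    forall psi, succeeds G A (tensor (g s) *m psi) -> succeeds G A' psi].
  elim: s => [_|j s IH /= /andP[js /IH[A' [A'cz cA' SA']]]].
    exists A; split=> // psi.
    have -> : tensor (g [::]) = 1%:M by rewrite -ptensor1; apply: eq_tensor.
    by rewrite mul1mx.
  exists (Gate1 j (Hf j) A'); split=> //= psi S; apply: SA'; move: S.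
  rewrite mulmxA; congr (succeeds _ _ (_ *m _)).
  rewrite (on_wires_tensor (g := fun i a b => if i == j then f j a b else (a == b)%:R)).
  - rewrite tensor_mul; apply: eq_tensor => i a b; rewrite bool_mulE /g inE.
    have [->|ij] := eqVneq i j.
      rewrite (negPf js); case: a; case: b;
        by rewrite /= !(mul1r, mul0r, addr0, add0r).
    by case: (i \in s); case: b; rewrite /= !(mulr1, mulr0, addr0, add0r).
  - exact: wires1_inj.
  - by move=> i a b; rewrite /wires1 eqxx.
  by move=> i; rewrite codom_wires1 => /negPf->.
have [A' [? ? SA']] := layer _ (enum_uniq 'I_k).
exists A'; split=> // psi S; apply: SA'; move: S; congr (succeeds _ _ (_ *m _)).
by apply: eq_tensor => j a b; rewrite /g mem_enum.
Qed.

Lemma convert_to_cz n (G : set (state R n)) k (A : algo R n k) (psi : state R k) :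
  (forall a phi, G phi -> G (a *: phi)) -> stabilized psi -> succeeds G A psi ->
  exists (s : {perm 'I_k}) (A' : algo R n k),
    [/\ only_cz A', (cz_complexity A' <= cz_complexity A)%N &
        succeeds G A' (perm_state s psi)].
Proof.
move=> GZ; elim: k / A psi => [psi Hs S|k q next IH psi Hs S|k q U HU next IH psi Hs S|
    k p q pq U HU next IH psi Hs S] /=.
- by exists 1%g, (Stop R n); rewrite perm_state1.
- have [b [g [mu E]]] := measure_correction q Hs.
  (* Only the continuation of outcome [b] is converted; both outcomes will use [s] and [A], so the
     cost stays below that of the more expensive original branch. *)
  have [s [A [Acz leA SA]]] := IH b _ (stabilized_measure q b Hs) (S b).
  (* The correction acts after the permutation [s], so position [j] receives the Pauli of qubit
     [s^-1 j]. *)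
  have gC j : clifford (tensor (fun _ : 'I_1 => pauli_mx R (g ((s^-1)%g j)))).
    exact: (ptensor_clifford R (fun=> g ((s^-1)%g j))).
  have [A' [A'cz cA' SA']] := local_layer G A gC.
  exists (lift_perm q q s), (Measure q (fun c => if c == b then A else A')); split.
  + by move=> c /=; case: eqP => // _; apply: A'cz.
  + by case: b leA {E SA} => leA; rewrite /= cA' maxnn (leq_trans leA) //
      ?leq_maxl ?leq_maxr.
  move=> c /=; rewrite measure_perm; case: eqP => [->//|/eqP cb].
  have {cb} -> : c = ~~ b by case: (c) (b) cb => [] [].
  (* Applied a second time, the Pauli cancels; [mu] times the permuted state of outcome [b] remains,
     possibly with [mu] zero. *)
  apply: SA'; rewrite E perm_stateZ perm_tensor -scalemxAr mulmxA tensor_mul.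
  apply: succeedsZ => //; move: SA; congr (succeeds _ _ _).
  rewrite -[LHS]mul1mx; congr (_ *m _).
  by rewrite -(ptensorK _ (fun j => g ((s^-1)%g j))) tensor_mul.
- have Hs' := stabilized_on_wires (@wires1_inj _ q) HU Hs.
  have [s [A [Acz leA SA]]] := IH _ Hs' S.
  by exists s, (Gate1 (s q) HU A); split=> //=; rewrite perm_on_wires in SA.
have Hs' := stabilized_on_wires (wires2_inj pq) HU Hs.
have [s [A [Acz leA SA]]] := IH _ Hs' S.
have [s' [A' [A'cz leA' SA']]] := simulable_clifford HU pq Acz SA.
by exists s', A'; split=> //; rewrite (leq_trans leA') // add1n ltnS.
Qed.

End Conversion.

(** * Preparation of graph states and attainment of the minimal cost *)

Section GraphStates.
Variables (R : realType) (n : nat).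
Local Notation C := R[i].

Definition graph_pauli (e : rel 'I_n) (v w : 'I_n) :=
  if w == v then PauliX else if e v w then PauliZ else PauliI.

Lemma graph_stabilizerE e v : graph_stabilizer R e v = ptensor R (graph_pauli e v).
Proof. by []. Qed.

(** CZ turns X at [p] into X at [p] times Z at [q], and likewise with [p] and [q] exchanged, and it
    commutes with Z. As [p] and [q] are not adjacent in [e'], X never meets Y on these two wires and
    no sign appears. *)
Lemma graph_state_add_edge (e e' : rel 'I_n) p q (psi : state R n) : p != q ->
  ~~ e' p q -> ~~ e' q p ->
  (forall i j, e i j = [|| e' i j, (i == p) && (j == q) | (i == q) && (j == p)]) ->
  is_graph_state e' psi ->
  is_graph_state e (on_wires (wires2 p q) (cz_gate R) *m psi).
Proof.
move=> pq epq eqp eE [psi1 Hpsi].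
have w_inj := wires2_inj pq.
split.
  by rewrite sqnorm_unitary // on_wires_unitary //; case: (cz_clifford R).
move=> v; rewrite graph_stabilizerE mulmxA.
suff <- : on_wires (wires2 p q) (cz_gate R) *m ptensor R (graph_pauli e' v) =
    ptensor R (graph_pauli e v) *m on_wires (wires2 p q) (cz_gate R).
  by rewrite -mulmxA -graph_stabilizerE Hpsi.
rewrite -[RHS]scale1r; apply: on_wires_conj_tensor => //.
  move=> j; rewrite codom_wires2 negb_or => /andP[/negPf jp /negPf jq].
  by rewrite /graph_pauli eE jp jq !andbF !orbF.
have W f : tensor (fun i => pauli_mx R (f (wires2 p q i))) =
    ptensor R (pair_pauli (f p) (f q)).
  by apply: eq_tensor => i a b; rewrite /wires2 /pair_pauli; case: ifP.
rewrite !W cz_pair /graph_pauli !eE !eqxx [q == p]eq_sym (negPf pq) !andbT !andbF /=.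
have [<-|vp] := eqVneq p v.
  by rewrite [q == p]eq_sym (negPf pq) (negPf epq).
have [<-|vq] := eqVneq q v.
  by rewrite (negPf eqp) ?eqxx ?orbT.
rewrite !orbF.
by case: (e' v p); case: (e' v q).
Qed.

(** The Hadamard layer conjugates Z at [v], which fixes the zero state, into X at [v]. *)
Lemma empty_graph_state (e : rel 'I_n) : (forall i j, ~~ e i j) ->
  is_graph_state e
    (tensor (fun=> swap_pauli_mx R PauliX PauliZ) *m zero_state R n).
Proof.
move=> e0; split.
  rewrite sqnorm_unitary ?sqnorm_zero_state //; apply/unitarymxP.
  by rewrite swap_pauli_tensor_adj swap_pauli_tensorK.
move=> v; pose h (j : 'I_n) := if j == v then PauliZ else PauliI.
rewrite graph_stabilizerE mulmxA.
have -> : graph_pauli e v = fun j => swap_pauli PauliX PauliZ (h j).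
  by apply/funext => j; rewrite /graph_pauli /h (negPf (e0 _ _)); case: eqP.
have := swap_pauli_tensorE R h (isT : anticomm1 PauliX PauliZ).
rewrite big1 => [|j _]; last by rewrite /h; case: eqP.
rewrite scale1r => <-; rewrite -mulmxA ptensor_zero_state // => j.
by rewrite /h; case: eqP.
Qed.

Definition graph_state_multiples (e : rel 'I_n) : set (state R n) :=
  [set phi | exists (c : C) (psi : state R n), is_graph_state e psi /\ phi = c *: psi].

Lemma graph_state_algo (e : rel 'I_n) : symmetric e -> irreflexive e ->
  exists A : algo R n n, succeeds (graph_state_multiples e) A (zero_state R n).
Proof.
move=> e_sym e_irr; pose G := graph_state_multiples e.
(* The graph already built while the pairs in [s] are still to be treated: an edge enters when the
   last of its two orientations leaves the list, hence only once. *)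
pose rest (s : seq ('I_n * 'I_n)) i j :=
  [&& e i j, (i, j) \notin s & (j, i) \notin s].
have rest_sym s i j : rest s i j = rest s j i.
  by rewrite /rest e_sym; congr (_ && _); apply: andbC.
have rest_cons p q s i j : rest ((p, q) :: s) i j =
    [&& rest s i j, (i, j) != (p, q) & (j, i) != (p, q)].
  rewrite /rest !inE !negb_or.
  by case: (e i j); case: ((i, j) \in s); case: ((j, i) \in s);
    case: (_ == _); case: (_ == _).
have edges s psi : is_graph_state (rest s) psi ->
    exists A : algo R n n, succeeds G A psi.
  elim: s psi => [|[p q] s IH] psi Gpsi.
    exists (Stop R n); right; exists 1, psi; rewrite scale1r; split=> //.
    suff <- : rest [::] = e by [].
    by apply/funext => i; apply/funext => j; rewrite /rest !andbT.
  have [pqs|pqs] := boolP (rest s p q); last first.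
    apply: IH; suff <- : rest ((p, q) :: s) = rest s by [].
    apply/funext => i; apply/funext => j; rewrite rest_cons.
    case: eqP => [[-> ->]|_]; first by rewrite (negPf pqs).
    by case: eqP => [[-> ->]|_]; rewrite ?andbT // rest_sym (negPf pqs).
  have pq : p != q.
    by case/andP: pqs => epq _; apply: contraTneq epq => ->; rewrite e_irr.
  have [|A SA] := IH (on_wires (wires2 p q) (cz_gate R) *m psi).
    apply: graph_state_add_edge Gpsi => //; rewrite ?rest_cons ?eqxx ?andbF //.
    move=> i j; rewrite rest_cons !xpair_eqE [(j == p) && _]andbC.
    case: (boolP ((i == p) && (j == q))) => [/andP[/eqP-> /eqP->]|_].
      by rewrite pqs orbT.
    case: (boolP ((i == q) && (j == p))) => [/andP[/eqP-> /eqP->]|_].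
      by rewrite rest_sym pqs orbT.
    by case: (rest s i j).
  by exists (Gate2 pq (cz_clifford R) A).
pose all_pairs := enum {: 'I_n * 'I_n}.
have H_clifford (j : 'I_n) :
    clifford (tensor (fun _ : 'I_1 => swap_pauli_mx R PauliX PauliZ)).
  exact: swap_pauli_clifford.
have [|A SA] := edges all_pairs
    (tensor (fun=> swap_pauli_mx R PauliX PauliZ) *m zero_state R n).
  by apply: empty_graph_state => i j; rewrite /rest !mem_enum andbF.
have [A' [_ _ SA']] := local_layer G A H_clifford.
by exists A'; apply: SA'.
Qed.

Lemma generatesP (e : rel 'I_n) k (A : algo R n k) :
  generates e A <-> succeeds (graph_state_multiples e) A (zero_state R k).
Proof. by rewrite -succeedsP sqnorm_zero_state. Qed.

Lemma graph_state_multiplesZ (e : rel 'I_n) a phi :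
  graph_state_multiples e phi -> graph_state_multiples e (a *: phi).
Proof. by move=> [c [psi [Gpsi ->]]]; exists (a * c), psi; rewrite scalerA. Qed.

(** By [graph_state_algo] the set of costs is nonempty, so it has a least element and the default
    value of [xget] is not taken. *)
Lemma Gamma_czP (e : rel 'I_n) : symmetric e -> irreflexive e ->
  (exists s (A : algo R n (n + s)), generates e A /\ cz_complexity A = Gamma_cz R e) /\
  forall s (A : algo R n (n + s)), generates e A -> (Gamma_cz R e <= cz_complexity A)%N.
Proof.
move=> e_sym e_irr; pose costs : set nat := [set m | exists s (A : algo R n (n + s)),
  generates e A /\ cz_complexity A = m].
rewrite /Gamma_cz -/costs.
have [m0 cm0] : exists m, costs m.
  have [A0 SA0] := graph_state_algo e_sym e_irr.
  have [A SA] : exists A : algo R n (n + 0),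
      succeeds (graph_state_multiples e) A (zero_state R (n + 0)).
    by rewrite addn0; exists A0.
  by exists (cz_complexity A), 0%N, A; split=> //; apply/generatesP.
have [m [cm minm]] : exists m, costs m /\ forall m', costs m' -> (m <= m')%N.
  have ex : exists m, `[< costs m >] by exists m0; apply/asboolP.
  case: (ex_minnP ex) => m /asboolP cm minm; exists m; split=> // m' cm'.
  by apply: minm; apply/asboolP.
case: xgetP => [g _ [cg ming]|/(_ m) nm]; last by case: nm.
split; first by have [s [A HA]] := cg; exists s, A.
by move=> s A HA; apply: ming; exists s, A.
Qed.

End GraphStates.

Theorem proposition2 (R : realType) (n : nat) (e : rel 'I_n)
    (e_sym : symmetric e) (e_irr : irreflexive e) :
  exists (s : nat) (A : algo R n (n + s)),
    [/\ generates e A, cz_complexity A = Gamma_cz R e & only_cz A].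
Proof.
have [[s [A [/generatesP SA cA]]] min] := Gamma_czP R e_sym e_irr.
have [t [A' [A'cz leA' SA']]] :=
  convert_to_cz (@graph_state_multiplesZ R n e) (@stabilized_zero_state R _) SA.
rewrite perm_state_zero in SA'; move/generatesP in SA'.
exists s, A'; split=> //; apply/eqP.
(* The converted algorithm competes in the minimum too, with the same [s], so its cost cannot drop
   below [Gamma_cz]. *)
by rewrite eqn_leq min // -cA leA'.
Qed.
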